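(* Let $f$ be a field of characteristic $0$, and let $m\ge 0$ and $n>m$ be integers. If $n\le 2m+2$, then $U_{m+1,n+1}$ is commutative. If $n\ge 2m+2$, then the center of $U_{m+1,n+1}$ is $f[l_n,l_{n-1},\dots,l_{n-m}]$ when $n$ is odd, and $f[l_n,l_{n-1},\dots,l_{n-m},P_{mk}(l_n,l_{n-1},\dots,l_{n/2})]$ with $k=(n/2)-m$ when $n$ is even, where the polynomials $P_{mk}$ are the coefficients of the generating function $$\sum_{k=1}^{\infty}P_{mk}(x_0,x_1,\dots,x_{m+k})z^k=\frac{\sqrt{\sum_{k=0}^{\infty}x_kx_0^{k-1}z^k}-\sqrt{\sum_{k=0}^{m}x_kx_0^{k-1}z^k}}{x_0^mz^m}.$$
   Context: $W_1$ is the Lie algebra of $f$-derivations of $f[[t]]$, i.e. of formal expressions $\sum_{i\ge -1}a_il_i$ with $a_i\in f$, $l_i=t^{i+1}\frac{\partial}{\partial t}$, so $[l_i,l_j]=(j-i)l_{i+j}$. $L_n\subset W_1$ is the subalgebra of elements with $a_i=0$ for $i<n$. For $0\le m<n$, $L_n$ is an ideal of $L_m$ and $L_{mn}=L_m/L_n$, a Lie algebra of dimension $n-m$ with basis the classes of $l_m,\dots,l_{n-1}$ (still denoted $l_i$), satisfying $[l_i,l_j]=(j-i)l_{i+j}$ with $l_{i+j}=0$ if $i+j\ge n$. $U_{mn}$ is the universal enveloping algebra of $L_{mn}$. In the generating function, the series under each square root have constant term $x_0x_0^{-1}=1$ in $z$, and the square root is the power series in $z$ with constant term $1$. For even $n\geq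 2m+2$ the elements $l_n,l_{n-1},\dots,l_{n/2}$ of $U_{m+1,n+1}$ commute with each other, so substituting them in $P_{mk}$ is meaningful. *)

(* Defs.v *)
From HB Require Import structures.
From mathcomp Require Import all_boot all_order all_algebra.
From mathcomp Require Import generic_quotient fraction.
From mathcomp Require Import boolp mpoly ring.

Set Implicit Arguments.
Unset Strict Implicit.
Unset Printing Implicit Defensive.

Import GRing.Theory.
Local Open Scope ring_scope.
Local Open Scope quotient_scope.

HB.mixin Record Lmodule_isLie (f : fieldType) L of GRing.Lmodule f L := {
  lie : L -> L -> L;
  lie_linearl : forall z, linear (lie^~ z);
  lie_linearr : forall x, linear (lie x);
  liexx : forall x, lie x x = 0;
  lie_jacobi : forall x y z,
    lie x (lie y z) + lie y (lie z x) + lie z (lie x y) = 0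
}.

#[short(type="lieAlgType")]
HB.structure Definition LieAlgebra (f : fieldType) :=
  {L of Lmodule_isLie f L & GRing.Lmodule f L}.

Section Witt.
Variable f : fieldType.

(* The sequence a stands for the derivation (\sum_r a r * t^r) d/dt, that is
   for the formal expression \sum_(i >= -1) a_i l_i with a_i := a i.+1: the
   index is shifted by one since l_i = t^(i+1) d/dt starts at i = -1.       *)
Definition W1 := nat -> f.

(* Since [l_i, l_j] = (j - i) l_(i+j), the coefficient of l_(r-1) in
   [\sum a_i l_i, \sum b_j l_j] is the sum over i + j = r - 1 of
   (j - i) a_i b_j; here p = i + 1 and r.+1 - p = j + 1.                    *)
Definition W1_lie (a b : W1) : W1 := fun r =>
  \sum_(p < r.+2) ((r.+1 - p)%:R - p%:R) * (a p * b (r.+1 - p)%N).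

Definition W1_l (i : nat) : W1 := fun r => (r == i.+1)%:R.

(* Membership in the subalgebra L_n, n >= 0. *)
Definition inL (n : nat) (a : W1) : Prop := forall r, (r <= n)%N -> a r = 0.

(* The quotient L_{m,n} = L_m / L_n.  The coset of \sum_(i >= m) a_i l_i is
   represented by (a_m, ..., a_(n-1)).                                      *)
Definition Lquo (m n : nat) : Type := 'rV[f]_(n - m).

HB.instance Definition _ m n := GRing.Lmodule.on (Lquo m n).

Variables m n : nat.

Definition Lclass (a : W1) : Lquo m n := \row_j a (m + j).+1.

Definition Lrepr (x : Lquo m n) : W1 :=
  fun r => \sum_(j < n - m | (m + j).+1 == r) x ord0 j.

Definition Lquo_lie (x y : Lquo m n) : Lquo m n :=
  Lclass (W1_lie (Lrepr x) (Lrepr y)).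

Definition Lquo_l (i : nat) : Lquo m n := Lclass (W1_l i).

End Witt.

Section WittTheory.
Variable f : fieldType.
Implicit Types a b c : W1 f.

Lemma W1_lieE N a b r : (r.+1 < N)%N ->
  let A := \poly_(i < N) a i in let B := \poly_(i < N) b i in
  W1_lie a b r = (A * B^`() - A^`() * B)`_r.
Proof.
move=> rN A B.
rewrite coefB !coefM /W1_lie.
have -> : \sum_(j < r.+1) A`_j * B^`()`_(r - j) =
          \sum_(p < r.+2) (r.+1 - p)%:R * (a p * b (r.+1 - p)%N).
  rewrite [RHS]big_ord_recr /= subnn mul0r addr0; apply: eq_bigr => j _.
  have jr : (j <= r)%N by rewrite -ltnS.
  rewrite coef_deriv !coef_poly -subSn //.
  have -> : (j < N)%N by apply: leq_ltn_trans jr (ltnW rN).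
  have -> : (r.+1 - j < N)%N by apply: leq_ltn_trans (leq_subr _ _) rN.
  by rewrite mulr_natl mulrnAr.
have -> : \sum_(j < r.+1) A^`()`_j * B`_(r - j) =
          \sum_(p < r.+2) p%:R * (a p * b (r.+1 - p)%N).
  rewrite [RHS]big_ord_recl /= mul0r add0r; apply: eq_bigr => j _.
  have jr : (j <= r)%N by rewrite -ltnS.
  rewrite coef_deriv !coef_poly /bump /= add1n subSS.
  have -> : (j.+1 < N)%N by apply: leq_ltn_trans rN.
  have -> : (r - j < N)%N by apply: leq_ltn_trans (leq_subr _ _) (ltnW rN).
  by rewrite mulr_natl mulrnAl.
by rewrite -sumrB; apply: eq_bigr => p _; rewrite mulrBl.
Qed.

Lemma W1_lie_local a a' b b' r :
  (forall p, (p <= r.+1)%N -> a p = a' p) ->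
  (forall p, (p <= r.+1)%N -> b p = b' p) ->
  W1_lie a b r = W1_lie a' b' r.
Proof.
move=> Ha Hb; apply: eq_bigr => p _.
by rewrite Ha ?Hb ?leq_subr // -ltnS.
Qed.

Lemma W1_liexx a r : W1_lie a a r = 0.
Proof. by rewrite (@W1_lieE r.+2) //= [_^`() * _]mulrC subrr coef0. Qed.

Lemma W1_jacobi a b c r :
  W1_lie a (W1_lie b c) r + W1_lie b (W1_lie c a) r
  + W1_lie c (W1_lie a b) r = 0.
Proof.
pose P a := \poly_(i < r.+3) a i : {poly f}.
pose br (A B : {poly f}) := A * B^`() - A^`() * B.
have H x y z : W1_lie x (W1_lie y z) r = (br (P x) (br (P y) (P z)))`_r.
  rewrite (@W1_lie_local _ (fun i => (P x)`_i) _ (fun i => (br (P y) (P z))`_i)).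
  - rewrite (@W1_lieE r.+3) //=.
    have -> : \poly_(i < r.+3) (P x)`_i = P x.
      by apply/polyP=> i; rewrite !coef_poly; case: (i < _)%N.
    set Q := br (P y) (P z); set Q' := \poly_(i < _) _.
    have eQ i : (i <= r.+1)%N -> Q'`_i = Q`_i.
      by move=> ir; rewrite coef_poly ltnS (leqW ir).
    rewrite /br !coefB !coefM; congr (_ - _); apply: eq_bigr => j _.
      by rewrite !coef_deriv eQ // ltnS leq_subr.
    by rewrite eQ // leqW // leq_subr.
  - by move=> p pr; rewrite coef_poly ltnS (leq_trans pr).
  - by move=> p pr; rewrite (@W1_lieE r.+3).
rewrite !H -!coefD.
suff -> : br (P a) (br (P b) (P c)) + br (P b) (br (P c) (P a))
  + br (P c) (br (P a) (P b)) = 0 by rewrite coef0.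
rewrite /br !derivB !derivM; ring.
Qed.

Lemma inL_lie m n a b : (m <= n)%N ->
  inL m a -> inL n b -> inL n (W1_lie a b).
Proof.
move=> mn Ha Hb r rn; apply: big1 => p _.
have [pm|mp] := leqP p m; first by rewrite Ha // mul0r mulr0.
rewrite Hb ?mulr0 // (leq_trans _ rn) // leq_subLR.
exact: leq_add (leq_ltn_trans (leq0n m) mp) (leqnn r).
Qed.

Lemma Lclass_linear m n k a b :
  Lclass m n (fun r => k * a r + b r) = k *: Lclass m n a + Lclass m n b.
Proof. by apply/rowP=> j; rewrite !mxE. Qed.

Lemma Lclass_ext m n a b : a =1 b -> Lclass m n a = Lclass m n b.
Proof. by move=> ab; apply/rowP=> j; rewrite !mxE. Qed.

Lemma LreprK m n : cancel (@Lrepr f m n) (Lclass m n).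
Proof.
move=> x; apply/rowP=> j; rewrite !mxE /Lrepr (big_pred1 j) // => i.
by rewrite eqSS eqn_add2l.
Qed.

Lemma inL_Lrepr m n (x : Lquo f m n) : inL m (Lrepr x).
Proof.
move=> r rm; apply: big_pred0 => j; apply/negbTE.
by rewrite neq_ltn orbC (leq_ltn_trans rm) // ltnS leq_addr.
Qed.

Lemma Lclass_eq0 m n a : (m <= n)%N -> inL m a ->
  (Lclass m n a = 0 <-> inL n a).
Proof.
move=> mn Ha; split=> [/rowP H r rn|H].
  have [rm|mr] := leqP r m; first exact: Ha.
  have lt : (r - m.+1 < n - m)%N.
    by rewrite ltn_subLR // addSn subnKC // ltnS.
  have := H (Ordinal lt); rewrite !mxE /= -addSn subnKC //.
by apply/rowP=> j; rewrite !mxE H // -ltn_subRL.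
Qed.

Lemma inL_Lrepr_class m n a : (m <= n)%N -> inL m a ->
  inL n (fun r => Lrepr (Lclass m n a) r - a r).
Proof.
move=> mn Ha r rn.
have [rm|mr] := leqP r m; first by rewrite Ha // inL_Lrepr // subrr.
have lt : (r - m.+1 < n - m)%N.
  by rewrite ltn_subLR // addSn subnKC // ltnS.
rewrite /Lrepr (big_pred1 (Ordinal lt)) => [|i]; last first.
  by rewrite -[RHS](eqn_add2l m.+1) /= subnKC.
by rewrite mxE /= -addSn subnKC // subrr.
Qed.

Lemma W1_lieDl k a a' b r :
  W1_lie (fun r => k * a r + a' r) b r = k * W1_lie a b r + W1_lie a' b r.
Proof.
rewrite /W1_lie mulr_sumr -big_split; apply: eq_bigr => p _ /=; ring.
Qed.

Lemma W1_lieDr k a b b' r :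
  W1_lie a (fun r => k * b r + b' r) r = k * W1_lie a b r + W1_lie a b' r.
Proof.
rewrite /W1_lie mulr_sumr -big_split; apply: eq_bigr => p _ /=; ring.
Qed.

Lemma Lrepr_linear m n k (x y : Lquo f m n) r :
  Lrepr (k *: x + y) r = k * Lrepr x r + Lrepr y r.
Proof.
by rewrite /Lrepr mulr_sumr -big_split; apply: eq_bigr => j _; rewrite !mxE.
Qed.

(* With Lclass_linear, Lclass_eq0 and LreprK this says that Lclass, restricted
   to L_m, is a surjective morphism of Lie algebras with kernel L_n.        *)
Lemma Lclass_lie m n a b : (m <= n)%N -> inL m a -> inL m b ->
  Lclass m n (W1_lie a b) = Lquo_lie (Lclass m n a) (Lclass m n b).
Proof.
move=> mn Ha Hb; rewrite /Lquo_lie.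
set a' := Lrepr _; set b' := Lrepr _.
have da := inL_Lrepr_class mn Ha; have db := inL_Lrepr_class mn Hb.
have Hb' : inL m b' by exact: inL_Lrepr.
apply/esym/eqP; rewrite -subr_eq0; apply/eqP.
transitivity (Lclass m n (fun r => -1 * W1_lie a b r + W1_lie a' b' r)).
  by rewrite Lclass_linear scaleN1r addrC.
have Hm : inL m (fun r => -1 * W1_lie a b r + W1_lie a' b' r).
  move=> r rm; rewrite (inL_lie (leqnn m) Ha Hb rm).
  by rewrite (inL_lie (leqnn m) (@inL_Lrepr m n _) Hb' rm) mulr0 addr0.
apply/(Lclass_eq0 mn Hm) => r rn.
have E1 := inL_lie mn Ha db rn.
have E2 := inL_lie mn Hb' da rn.
have : W1_lie (fun r => Lrepr (Lclass m n a) r - a r) b' r = 0.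
  have := W1_liexx (fun r => 1 * b' r + (Lrepr (Lclass m n a) r - a r)) r.
  by rewrite W1_lieDl !W1_lieDr !W1_liexx E2 !mul1r !(add0r, addr0).
rewrite -[W1_lie _ _ r]/(W1_lie (fun r => a' r - a r) b' r).
have -> : W1_lie (fun r => a' r - a r) b' r = -1 * W1_lie a b' r + W1_lie a' b' r.
  by rewrite -W1_lieDl; apply: W1_lie_local => // p _; rewrite mulN1r addrC.
move: E1; rewrite -/b'.
have -> : W1_lie a (fun r => b' r - b r) r = -1 * W1_lie a b r + W1_lie a b' r.
  by rewrite -W1_lieDr; apply: W1_lie_local => // p _; rewrite mulN1r addrC.
move=> E1 E3; rewrite -[RHS](addr0 0) -{1}E1 -E3; ring.
Qed.

Section Lie.
Variables m n : nat.
Implicit Types x y z : Lquo f m n.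

Lemma Lquo_lie_linearl z : linear (@Lquo_lie f m n ^~ z).
Proof.
move=> k x y; rewrite /Lquo_lie -Lclass_linear; apply: Lclass_ext => r.
by rewrite -W1_lieDl; apply: W1_lie_local => // p _; rewrite Lrepr_linear.
Qed.

Lemma Lquo_lie_linearr x : linear (@Lquo_lie f m n x).
Proof.
move=> k y z; rewrite /Lquo_lie -Lclass_linear; apply: Lclass_ext => r.
by rewrite -W1_lieDr; apply: W1_lie_local => // p _; rewrite Lrepr_linear.
Qed.

Lemma Lquo_liexx x : Lquo_lie x x = 0.
Proof. by apply/rowP=> j; rewrite !mxE W1_liexx. Qed.

Lemma Lquo_jacobi x y z :
  Lquo_lie x (Lquo_lie y z) + Lquo_lie y (Lquo_lie z x)
  + Lquo_lie z (Lquo_lie x y) = 0.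
Proof.
have [mn|nm] := leqP m n; last first.
  by apply/rowP => -[j jlt]; exfalso; move: jlt; rewrite (eqP (ltnW nm : _ - _ == 0)%N).
have L3 (u v w : Lquo f m n) : Lquo_lie u (Lquo_lie v w) =
    Lclass m n (W1_lie (Lrepr u) (W1_lie (Lrepr v) (Lrepr w))).
  have Lvw := inL_lie (leqnn m) (@inL_Lrepr m n v) (@inL_Lrepr m n w).
  by rewrite (Lclass_lie mn (@inL_Lrepr m n u) Lvw) LreprK.
by rewrite !L3; apply/rowP=> j; rewrite !mxE W1_jacobi.
Qed.

HB.instance Definition _ := Lmodule_isLie.Build f (Lquo f m n)
  Lquo_lie_linearl Lquo_lie_linearr Lquo_liexx Lquo_jacobi.

Lemma lie_Lquo_l i j : (m <= i)%N -> (m <= j)%N -> (m <= n)%N ->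
  lie (Lquo_l f m n i) (Lquo_l f m n j) = (j%:R - i%:R) *: Lquo_l f m n (i + j).
Proof.
move=> mi mj mn; have inl k : (m <= k)%N -> inL m (W1_l f k).
  by move=> mk r rm; rewrite /W1_l ltn_eqF // ltnS (leq_trans rm).
rewrite -[LHS]/(Lquo_lie _ _) -Lclass_lie; [|exact: mn|exact: inl|exact: inl].
apply/rowP=> k; rewrite !mxE; move: (m + k).+1 => r.
rewrite /W1_lie /W1_l.
have [ir|ri] := ltnP i.+1 r.+2; last first.
  rewrite big1 => [|p _]; last first.
    by rewrite [p == _ :> nat]ltn_eqF ?mul0r ?mulr0 // (leq_trans (ltn_ord p)).
  rewrite ltn_eqF ?mulr0 // ltnS (leq_trans _ (leq_addr _ _)) //.
  exact: ltnW.
rewrite (bigD1 (Ordinal ir)) //= big1 ?addr0 => [|p]; last first.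
  by rewrite -val_eqE /= => /negbTE->; rewrite mul0r mulr0.
have ir' : (i <= r)%N by [].
rewrite eqxx mul1r subSS -(eqn_add2l i (r - i)%N) subnKC // addnS.
have [e|] := eqVneq; last by rewrite !mulr0.
rewrite e -addnS addKn !mulr1 -[j.+1]addn1 -[i.+1]addn1 !natrD; ring.
Qed.

End Lie.
End WittTheory.

Section Enveloping.
Variables (f : fieldType) (L : lieAlgType f).

Definition is_lie_morphism (A : algType f) (phi : {linear L -> A}) : Prop :=
  forall x y, phi (lie x y) = phi x * phi y - phi y * phi x.

Definition is_enveloping (U : algType f) (inc : {linear L -> U}) : Prop :=
  is_lie_morphism inc /\
  forall (A : algType f) (phi : {linear L -> A}), is_lie_morphism phi ->
  exists2 g : {lrmorphism U -> A}, (forall x, g (inc x) = phi x) &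
    forall g' : {lrmorphism U -> A}, (forall x, g' (inc x) = phi x) -> g' =1 g.

End Enveloping.

Definition in_center (f : fieldType) (U : algType f) (u : U) : Prop :=
  forall v : U, GRing.comm u v.

(* u belongs to the subalgebra generated by the elements of s. *)
Definition in_subalg (f : fieldType) (U : algType f) (s : seq U) (u : U) :
    Prop :=
  forall S : {pred U},
    GRing.subalg_closed S -> {subset s <= S} -> u \in S.

Section PowerSeries.
Variable K : fieldType.
Implicit Types a s x : nat -> K.

(* A sequence stands for the power series in z with these coefficients. *)
Definition is_sqrt1 a s : Prop :=
  s 0 = 1 /\ forall n, \sum_(i < n.+1) s i * s (n - i)%N = a n.

Definition radicand x : nat -> K := fun j => x j * x 0 ^ (j%:Z - 1).

Definition truncate (m : nat) a : nat -> K :=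
  fun j => if (j <= m)%N then a j else 0.

(* c is the coefficient of z^k in the generating function at x. *)
Definition is_genfun_coef (m k : nat) x (c : K) : Prop :=
  exists s t, [/\ is_sqrt1 (radicand x) s,
    is_sqrt1 (truncate m (radicand x)) t &
    c = (s (m + k) - t (m + k)) / x 0 ^+ m].

End PowerSeries.

Section Pmk.
Variable f : fieldType.

(* The indeterminates x_0, ..., x_N in f(x_0, ..., x_N).  The value 0 given to
   the x_j with j > N is immaterial for is_Pmk: the coefficient of z^k in the
   generating function only involves x_0, ..., x_(m+k), see
   genfun_coef_local.                                                       *)
Definition indet (N : nat) : nat -> {fraction {mpoly f[N.+1]}} :=
  fun j => if insub j is Some i then tofrac ('X_i : {mpoly f[N.+1]}) else 0.

Definition is_Pmk (m k : nat) (P : {mpoly f[(m + k).+1]}) : Prop :=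
  is_genfun_coef m k (indet (m + k)) (tofrac P).

End Pmk.
Arguments is_Pmk {f} m k P.

(* P(y 0, ..., y N) for pairwise commuting y i in an associative algebra. *)
Definition eval_mpoly (f : fieldType) (U : algType f) (N : nat)
    (P : {mpoly f[N.+1]}) (y : nat -> U) : U :=
  mmap (in_alg U) (fun i : 'I_N.+1 => y i) P.

Section Sqrt1Theory.
Variables (K : fieldType) (two_neq0 : 2%:R != 0 :> K).
Implicit Types a s x : nat -> K.

Lemma sqrt1_rec a s n : is_sqrt1 a s ->
  s n.+1 = 2%:R^-1 * (a n.+1 - \sum_(i < n) s i.+1 * s (n - i)%N).
Proof.
case=> s0 /(_ n.+1); rewrite big_ord_recl big_ord_recr /= subn0 subnn s0.
rewrite mul1r mulr1 => <-; apply: (mulfI two_neq0); rewrite mulVKf //.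
have -> : \sum_(i < n) s (bump 0 i) * s (n.+1 - bump 0 i)%N =
          \sum_(i < n) s i.+1 * s (n - i)%N by [].
ring.
Qed.

Lemma sqrt1_local a a' s s' n : is_sqrt1 a s -> is_sqrt1 a' s' ->
  (forall i, (i <= n)%N -> a i = a' i) -> s n = s' n.
Proof.
move=> Hs Hs'; elim/ltn_ind: n => -[|n] IH Ha; first by rewrite Hs.1 Hs'.1.
rewrite (sqrt1_rec _ Hs) (sqrt1_rec _ Hs') Ha //; congr (_ * (_ - _)).
apply: eq_bigr => i _; congr (_ * _); apply: IH.
- by rewrite ltnS.
- by move=> j ji; apply: Ha; rewrite (leq_trans ji) // leqW.
- by rewrite ltnS leq_subr.
- by move=> j ji; apply: Ha; rewrite (leq_trans ji) // leqW // leq_subr.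
Qed.

Lemma genfun_coef_local m k x x' c c' :
  is_genfun_coef m k x c -> is_genfun_coef m k x' c' ->
  (forall i, (i <= m + k)%N -> x i = x' i) -> c = c'.
Proof.
move=> [s [t [Hs Ht ->]]] [s' [t' [Hs' Ht' ->]]] xx.
have Hr i : (i <= m + k)%N -> radicand x i = radicand x' i.
  by move=> ile; rewrite /radicand !xx.
rewrite (sqrt1_local Hs Hs' Hr) (sqrt1_local Ht Ht') ?xx // => i ile.
by rewrite /truncate Hr.
Qed.

Fixpoint sqrt1_seq a n : seq K :=
  if n is n'.+1 then
    let s := sqrt1_seq a n' in
    rcons s (2%:R^-1 * (a n - \sum_(i < n') s`_i.+1 * s`_(n' - i)))
  else [:: 1].

Lemma sqrt1_exists a : a 0 = 1 -> exists s, is_sqrt1 a s.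
Proof.
move=> a0; pose s i := (sqrt1_seq a i)`_i; exists s.
have size_s n : size (sqrt1_seq a n) = n.+1.
  by elim: n => //= n IH; rewrite size_rcons IH.
have sE n i : (i <= n)%N -> (sqrt1_seq a n)`_i = s i.
  elim: n => [|n IH]; first by case: i.
  rewrite leq_eqVlt => /orP[/eqP->//|lt].
  by rewrite /= nth_rcons size_s lt IH.
split=> // -[|n]; first by rewrite big_ord1 mulr1 a0.
rewrite big_ord_recl big_ord_recr /= subn0 subnn {1}/s /= mul1r mulr1.
have -> : s n.+1 = 2%:R^-1 * (a n.+1 - \sum_(i < n) s i.+1 * s (n - i)%N).
  rewrite /s /= nth_rcons size_s ltnn eqxx; congr (_ * (_ - _)).
  by apply: eq_bigr => i _; rewrite !sE ?leq_subr.
have -> : \sum_(i < n) s (bump 0 i) * s (n.+1 - bump 0 i)%N =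
          \sum_(i < n) s i.+1 * s (n - i)%N by [].
by field.
Qed.

Lemma genfun_coef_exists (I : K -> Prop) m k x :
  I 1 -> I 2%:R^-1 -> (forall y, I y -> I (- y)) ->
  (forall y z, I y -> I z -> I (y + z)) ->
  (forall y z, I y -> I z -> I (y * z)) ->
  x 0 != 0 -> (forall j, I (x j)) ->
  exists c, is_genfun_coef m k x c /\ I c.
Proof.
move=> I1 Ihalf IN ID IM x0 Ix.
have I0 : I 0 by rewrite -(subrr 1); apply: (ID) => //; apply: (IN).
have Isum n (y : nat -> K) : (forall i, (i < n)%N -> I (y i)) ->
    I (\sum_(i < n) y i).
  elim: n => [|n IH] H; first by rewrite big_ord0.
  by rewrite big_ord_recr; apply: ID; [apply: IH => i /leqW/H|apply: H].
have IX n : I (x 0 ^+ n).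
  by elim: n => [|n IH]; rewrite ?expr0 // exprS; apply: (IM).
have rad0 : radicand x 0 = 1 by rewrite /radicand sub0r -invr_expz expr1z divff.
have radS j : radicand x j.+1 = x j.+1 * x 0 ^+ j.
  have e : j.+1%:Z - 1 = j by rewrite -[j.+1]addn1 PoszD addrK.
  by rewrite /radicand e.
have Irad j : I (radicand x j) by case: j => [|j]; rewrite ?rad0 // radS; apply: (IM).
have [s Hs] := sqrt1_exists rad0.
have [t Ht] : exists t, is_sqrt1 (truncate m (radicand x)) t.
  exact: sqrt1_exists.
have Isqrt a s' : (forall j, I (a j)) -> is_sqrt1 a s' -> forall n, I (s' n).
  move=> Ia H; elim/ltn_ind=> -[|n] IH; first by rewrite H.1.
  rewrite (sqrt1_rec _ H); apply: (IM) => //; apply: (ID) => //; apply: (IN).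
  apply: (Isum _ (fun i => s' i.+1 * s' (n - i)%N)) => i ni.
  by apply: (IM); apply: IH; rewrite ltnS // leq_subr.
have Is := Isqrt _ _ Irad Hs.
have It : forall n, I (t n).
  apply: (Isqrt _ t _ Ht) => j; rewrite /truncate; case: ifP => // _; exact: I0.
suff H n : I ((s n - t n) / x 0 ^+ m).
  by exists ((s (m + k)%N - t (m + k)%N) / x 0 ^+ m); split; first by exists s, t.
elim/ltn_ind: n => n IH.
have E : \sum_(i < n.+1) (s i - t i) * (s (n - i)%N + t (n - i)%N) =
    radicand x n - truncate m (radicand x) n.
  rewrite -(Hs.2 n) -(Ht.2 n).
  have -> : \sum_(i < n.+1) (s i - t i) * (s (n - i)%N + t (n - i)%N) =
      \sum_(i < n.+1) s i * s (n - i)%N - \sum_(i < n.+1) t i * t (n - i)%N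
      + (\sum_(i < n.+1) s i * t (n - i)%N - \sum_(i < n.+1) t i * s (n - i)%N).
    by rewrite -!sumrB -big_split; apply: eq_bigr => i _ /=; ring.
  suff -> : \sum_(i < n.+1) s i * t (n - i)%N =
            \sum_(i < n.+1) t i * s (n - i)%N by rewrite subrr addr0.
  rewrite (reindex_inj rev_ord_inj); apply: eq_bigr => i _ /=.
  by rewrite subSS subKn 1?mulrC // -ltnS.
rewrite big_ord_recr /= subnn Hs.1 Ht.1 in E.
have -> : (s n - t n) / x 0 ^+ m = 2%:R^-1 *
   ((radicand x n - truncate m (radicand x) n) / x 0 ^+ m
    - \sum_(i < n) ((s i - t i) / x 0 ^+ m * (s (n - i)%N + t (n - i)%N))).
  have -> : \sum_(i < n) ((s i - t i) / x 0 ^+ m * (s (n - i)%N + t (n - i)%N))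
     = (\sum_(i < n) ((s i - t i) * (s (n - i)%N + t (n - i)%N))) / x 0 ^+ m.
    by rewrite mulr_suml; apply: eq_bigr => i _; rewrite mulrAC.
  by rewrite -E; field; rewrite two_neq0 expf_neq0.
apply: (IM) => //; apply: (ID); last first.
  apply: (IN); apply: (Isum _ (fun i => (s i - t i) / x 0 ^+ m * (s (n - i)%N + t (n - i)%N))).
  by move=> i ni; apply: (IM); [apply: IH|apply: (ID)].
rewrite /truncate; case: leqP => [_|mn].
  by rewrite subrr mul0r; exact: I0.
case: n mn {IH E} => // n mn; rewrite subr0 radS -(subnK (mn : m <= n)%N) exprD.
by rewrite mulrA mulfK ?expf_neq0 //; apply: (IM).
Qed.

End Sqrt1Theory.

Section PmkTheory.
Variables (f : fieldType) (f_char0 : [pchar f] =i pred0).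

Let two_neq0 N : 2%:R != 0 :> {fraction {mpoly f[N]}}.
Proof.
have /negbT := f_char0 2; rewrite inE /= => h2.
by rewrite -(rmorph_nat (@tofrac _)) tofrac_eq0 -mpolyC_nat mpolyC_eq0.
Qed.

Lemma Pmk_uniq m k (P Q : {mpoly f[(m + k).+1]}) :
  is_Pmk m k P -> is_Pmk m k Q -> P = Q.
Proof.
move=> HP HQ; apply/eqP; rewrite -tofrac_eq; apply/eqP.
exact: (genfun_coef_local (two_neq0 _) HP HQ).
Qed.

Lemma Pmk_exists m k : exists P : {mpoly f[(m + k).+1]}, is_Pmk m k P.
Proof.
set N := (m + k)%N; set x := @indet f N; pose F := {fraction {mpoly f[N.+1]}}.
have two0 : 2%:R != 0 :> F by exact: two_neq0.
pose I (y : F) := exists p : {mpoly f[N.+1]}, y = tofrac p.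
have ID y z : I y -> I z -> I (y + z).
  by move=> [p ->] [q ->]; exists (p + q); rewrite rmorphD.
have IN y : I y -> I (- y) by move=> [p ->]; exists (- p); rewrite rmorphN.
have IM y z : I y -> I z -> I (y * z).
  by move=> [p ->] [q ->]; exists (p * q); rewrite rmorphM.
have I1 : I 1 by exists 1; rewrite rmorph1.
have Ihalf : I 2%:R^-1.
  exists (2%:R^-1)%:MP; apply: (mulfI two0); rewrite divff //.
  rewrite -[2%:R](rmorph_nat (@tofrac _)) -rmorphM -mpolyC_nat -mpolyCM.
  rewrite divff ?rmorph1 //.
  by have /negbT := f_char0 2; rewrite inE.
have x0 : x 0 != 0.
  rewrite /x /indet insubT tofrac_eq0 -msupp_eq0 msuppX //.
have Ix j : I (x j).
  rewrite /x /indet; case: insub => [i|]; first by exists 'X_i.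
  by exists 0; rewrite rmorph0.
have [c [Hc [P cP]]] := genfun_coef_exists two0 m k I1 Ihalf IN ID IM x0 Ix.
by exists P; rewrite /is_Pmk -cP.
Qed.

End PmkTheory.

Section EnvelopingExists.
Variables (f : fieldType) (L : lieAlgType f).

Inductive term : Type :=
  | Var of L | Cst of f | Add of term & term | Mul of term & term.

HB.instance Definition _ := gen_eqMixin term.
HB.instance Definition _ := gen_choiceMixin term.

Inductive eqv : term -> term -> Prop :=
  | eqv_refl s : eqv s s
  | eqv_sym s t : eqv s t -> eqv t s
  | eqv_trans s t u : eqv s t -> eqv t u -> eqv s u
  | eqv_add s s' t t' : eqv s s' -> eqv t t' -> eqv (Add s t) (Add s' t')
  | eqv_mul s s' t t' : eqv s s' -> eqv t t' -> eqv (Mul s t) (Mul s' t')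
  | eqv_addA s t u : eqv (Add s (Add t u)) (Add (Add s t) u)
  | eqv_addC s t : eqv (Add s t) (Add t s)
  | eqv_add0 s : eqv (Add (Cst 0) s) s
  | eqv_mulA s t u : eqv (Mul s (Mul t u)) (Mul (Mul s t) u)
  | eqv_mul1 s : eqv (Mul (Cst 1) s) s
  | eqv_mul0 s : eqv (Mul (Cst 0) s) (Cst 0)
  | eqv_mulDl s t u : eqv (Mul (Add s t) u) (Add (Mul s u) (Mul t u))
  | eqv_mulDr s t u : eqv (Mul s (Add t u)) (Add (Mul s t) (Mul s u))
  | eqv_cstC a s : eqv (Mul (Cst a) s) (Mul s (Cst a))
  | eqv_cstD a b : eqv (Cst (a + b)) (Add (Cst a) (Cst b))
  | eqv_cstM a b : eqv (Cst (a * b)) (Mul (Cst a) (Cst b))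
  | eqv_varD x y : eqv (Var (x + y)) (Add (Var x) (Var y))
  | eqv_varZ a x : eqv (Var (a *: x)) (Mul (Cst a) (Var x))
  | eqv_lie x y : eqv (Var (lie x y))
      (Add (Mul (Var x) (Var y)) (Mul (Cst (-1)) (Mul (Var y) (Var x)))).

Definition eqvb s t := `[< eqv s t >].

Lemma eqvb_refl : reflexive eqvb.
Proof. by move=> s; apply/asboolP/eqv_refl. Qed.

Lemma eqvb_sym : ssrbool.symmetric eqvb.
Proof. by move=> s t; apply/asboolP/asboolP; apply: eqv_sym. Qed.

Lemma eqvb_trans : transitive eqvb.
Proof.
by move=> t s u /asboolP st /asboolP tu; apply/asboolP; apply: eqv_trans tu.
Qed.

Canonical eqvb_equiv := EquivRel eqvb eqvb_refl eqvb_sym eqvb_trans.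

Definition env : Type := {eq_quot eqvb_equiv}.
HB.instance Definition _ := Choice.on env.
HB.instance Definition _ := Quotient.on env.

Lemma env_eq s t : eqv s t -> \pi_env s = \pi_env t.
Proof. by move=> st; apply/eqmodP/asboolP. Qed.

Lemma eqv_repr s : eqv (repr (\pi_env s)) s.
Proof. by have /eqmodP/asboolP := reprK (\pi_env s). Qed.

Definition env_add (u v : env) : env :=
  locked (\pi_env (Add (repr u) (repr v))).
Definition env_mul (u v : env) : env :=
  locked (\pi_env (Mul (repr u) (repr v))).
Definition env_cst (a : f) : env := \pi_env (Cst a).
Definition env_opp (u : env) : env := env_mul (env_cst (-1)) u.

Lemma env_addE s t : env_add (\pi_env s) (\pi_env t) = \pi_env (Add s t).
Proof. by rewrite /env_add -lock; apply/env_eq/eqv_add; apply: eqv_repr. Qed.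

Lemma env_mulE s t : env_mul (\pi_env s) (\pi_env t) = \pi_env (Mul s t).
Proof. by rewrite /env_mul -lock; apply/env_eq/eqv_mul; apply: eqv_repr. Qed.

Definition envE := (env_addE, env_mulE).

Lemma env_addA : associative env_add.
Proof.
elim/quotW=> s; elim/quotW=> t; elim/quotW=> u; rewrite !envE.
exact/env_eq/eqv_addA.
Qed.

Lemma env_addC : commutative env_add.
Proof.
by elim/quotW=> s; elim/quotW=> t; rewrite !envE; apply/env_eq/eqv_addC.
Qed.

Lemma env_add0 : left_id (env_cst 0) env_add.
Proof. by elim/quotW=> s; rewrite !envE; apply/env_eq/eqv_add0. Qed.

Lemma env_mulA : associative env_mul.
Proof.
elim/quotW=> s; elim/quotW=> t; elim/quotW=> u; rewrite !envE.
exact/env_eq/eqv_mulA.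
Qed.

Lemma env_cstC a u : env_mul (env_cst a) u = env_mul u (env_cst a).
Proof. by elim/quotW: u => s; rewrite !envE; apply/env_eq/eqv_cstC. Qed.

Lemma env_mul1 : left_id (env_cst 1) env_mul.
Proof. by elim/quotW=> s; rewrite !envE; apply/env_eq/eqv_mul1. Qed.

Lemma env_mulr1 : right_id (env_cst 1) env_mul.
Proof. by move=> u; rewrite -env_cstC env_mul1. Qed.

Lemma env_mulDl : left_distributive env_mul env_add.
Proof.
elim/quotW=> s; elim/quotW=> t; elim/quotW=> u; rewrite !envE.
exact/env_eq/eqv_mulDl.
Qed.

Lemma env_mulDr : right_distributive env_mul env_add.
Proof.
elim/quotW=> s; elim/quotW=> t; elim/quotW=> u; rewrite !envE.
exact/env_eq/eqv_mulDr.
Qed.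

Lemma env_cstD a b : env_cst (a + b) = env_add (env_cst a) (env_cst b).
Proof. by rewrite !envE; apply/env_eq/eqv_cstD. Qed.

Lemma env_cstM a b : env_cst (a * b) = env_mul (env_cst a) (env_cst b).
Proof. by rewrite !envE; apply/env_eq/eqv_cstM. Qed.

Section Interp.
Variables (A : algType f) (phi : {linear L -> A}).
Hypothesis phi_lie : is_lie_morphism phi.

Fixpoint interp (s : term) : A :=
  match s with
  | Var x => phi x
  | Cst a => a%:A
  | Add s t => interp s + interp t
  | Mul s t => interp s * interp t
  end.

Lemma interp_eqv s t : eqv s t -> interp s = interp t.
Proof.
elim=> //= {s t}.
- by move=> s t u _ -> _ ->.
- by move=> s s' t t' _ -> _ ->.
- by move=> s s' t t' _ -> _ ->.
- by move=> s t u; rewrite addrA.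
- by move=> s t; rewrite addrC.
- by move=> s; rewrite scale0r add0r.
- by move=> s t u; rewrite mulrA.
- by move=> s; rewrite scale1r mul1r.
- by move=> s; rewrite scale0r mul0r.
- by move=> s t u; rewrite mulrDl.
- by move=> s t u; rewrite mulrDr.
- by move=> a s; rewrite mulr_algl mulr_algr.
- by move=> a b; rewrite scalerDl.
- by move=> a b; rewrite mulr_algl scalerA.
- by move=> x y; rewrite linearD.
- by move=> a x; rewrite linearZ mulr_algl.
- by move=> x y; rewrite phi_lie scaleN1r mulN1r.
Qed.

Definition env_lift (u : env) : A := interp (repr u).

Lemma env_liftE s : env_lift (\pi_env s) = interp s.
Proof. exact/interp_eqv/eqv_repr. Qed.

End Interp.

Lemma env_cst1_neq0 : env_cst 1 != env_cst 0.
Proof.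
pose z : {linear L -> f^o} := \0.
have Hz : is_lie_morphism z by move=> x y; rewrite /z /= mulr0 subrr.
apply/eqP => /(congr1 (env_lift z)); rewrite !env_liftE //= scale1r scale0r.
by move/eqP; rewrite oner_eq0.
Qed.

Lemma env_addN : left_inverse (env_cst 0) env_opp env_add.
Proof.
move=> u; rewrite /env_opp -{2}(env_mul1 u) -env_mulDl -env_cstD addNr.
by elim/quotW: u => s; rewrite env_mulE; apply/env_eq/eqv_mul0.
Qed.

HB.instance Definition _ := GRing.isZmodule.Build env
  env_addA env_addC env_add0 env_addN.
HB.instance Definition _ := GRing.Zmodule_isNzRing.Build env
  env_mulA env_mul1 env_mulr1 env_mulDl env_mulDr env_cst1_neq0.

Lemma env_scaleA a b (u : env) :
  env_mul (env_cst a) (env_mul (env_cst b) u) = env_mul (env_cst (a * b)) u.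
Proof. by rewrite env_cstM env_mulA. Qed.

Lemma env_scaleDl (u : env) :
  {morph (fun a => env_mul (env_cst a) u) : a b / a + b}.
Proof. by move=> a b; rewrite env_cstD env_mulDl. Qed.

HB.instance Definition _ := GRing.Zmodule_isLmodule.Build f env
  env_scaleA env_mul1 (fun a u v => env_mulDr (env_cst a) u v) env_scaleDl.
HB.instance Definition _ := GRing.Lmodule_isLalgebra.Build f env
  (fun a u v => env_mulA (env_cst a) u v).

Lemma env_scaleAr a (u v : env) : a *: (u * v) = u * (a *: v).
Proof.
rewrite -[LHS]/(env_mul (env_cst a) (env_mul u v)).
by rewrite env_mulA env_cstC -env_mulA.
Qed.

HB.instance Definition _ := GRing.Lalgebra_isAlgebra.Build f env env_scaleAr.

Lemma env_piD s t : \pi_env (Add s t) = (\pi_env s : env) + (\pi_env t : env).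
Proof. by rewrite -env_addE. Qed.

Lemma env_piM s t : \pi_env (Mul s t) = (\pi_env s : env) * (\pi_env t : env).
Proof. by rewrite -env_mulE. Qed.

Definition env_var (x : L) : env := \pi_env (Var x).

Lemma env_var_linear : linear env_var.
Proof.
move=> a x y; rewrite -[RHS]/(env_add (env_mul (env_cst a) (env_var x)) _).
rewrite !envE; apply/env_eq; apply: eqv_trans (eqv_varD _ _) _.
by apply: eqv_add (eqv_varZ _ _) (eqv_refl _).
Qed.

HB.instance Definition _ := GRing.isLinear.Build f L env *:%R env_var
  env_var_linear.

Lemma env_var_lie : is_lie_morphism env_var.
Proof.
move=> x y; rewrite -scaleN1r.
rewrite -[RHS]/(env_add (env_mul (env_var x) (env_var y))
  (env_mul (env_cst (-1)) (env_mul (env_var y) (env_var x)))) !envE.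
exact/env_eq/eqv_lie.
Qed.

Lemma env_enveloping : is_enveloping env_var.
Proof.
split=> [|A phi Hphi]; first exact: env_var_lie.
pose g := env_lift phi.
have gL : linear g.
  move=> a; elim/quotW=> s; elim/quotW=> t.
  rewrite -[_ + _]/(env_add (env_mul (env_cst a) _) _) !envE /g.
  by rewrite !env_liftE //= mulr_algl.
have gM : monoid_morphism g.
  split; first by rewrite -[1]/(env_cst 1) /g env_liftE //= scale1r.
  elim/quotW=> s; elim/quotW=> t; rewrite -[_ * _]/(env_mul _ _) envE /g.
  by rewrite !env_liftE.
pose G : {lrmorphism env -> A} := HB.pack g
  (GRing.isLinear.Build f env A *:%R g gL)
  (GRing.isMonoidMorphism.Build env A g gM).
exists G => [x|h Hh]; first exact: (env_liftE Hphi).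
elim/quotW; elim=> [x|a|s IHs t IHt|s IHs t IHt].
- by rewrite Hh /= /g env_liftE.
- have -> : \pi_env (Cst a) = a%:A.
    by rewrite -[RHS]/(env_mul (env_cst a) (env_cst 1)) -env_cstM mulr1.
  by rewrite !linearZ !rmorph1.
- by rewrite env_piD (rmorphD h) (rmorphD G); congr (_ + _).
- by rewrite env_piM (rmorphM h) (rmorphM G); congr (_ * _).
Qed.

End EnvelopingExists.

Lemma enveloping_exists (f : fieldType) (L : lieAlgType f) :
  exists (U : algType f) (inc : {linear L -> U}), is_enveloping inc.
Proof. by exists (env L), (@env_var f L); apply: env_enveloping. Qed.

(* Main.v *)
From HB Require Import structures.
Require Import Defs.
From mathcomp Require Import all_boot all_order all_algebra.
From mathcomp Require Import generic_quotient fraction boolp mpoly ring zify.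

Set Implicit Arguments.
Unset Strict Implicit.
Unset Printing Implicit Defensive.

Import GRing.Theory.
Local Open Scope ring_scope.

(** Write y_k = l_(n-k) for 0 <= k < n - m, so that
    [l_j, y_k] = (n - k - j) y_(k-j), where y_i = 0 for i < 0, and filter U by
    the length of words in the y_k.

    The associated graded algebra is the polynomial ring S in variables x_k.
    Words commute up to shorter words ([symbol_defect]), so every element of U
    is an ordered polynomial in the y_k up to lower terms.  That its symbol is
    well defined uses the pre-Lie product l_i . l_j = j l_(i+j), whose
    commutator is the bracket: thanks to it l_j acts on S by multiplication by
    its own variable plus a vector field that preserves degrees
    ([prelie_commutator]), and u |-> u . 1 recovers the symbol of u
    ([symbol_inj]).

    On symbols, bracketing with l_j is the vector field D_j sending x_k to
    (n - k - j) x_(k-j), so the symbol p of a central element is killed by all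
    the D_j.  Since D_j involves only the partial derivatives of index
    k >= j, with coefficient (n - 2 j) x_0 at k = j, this is a triangular system
    ([triangular]): p involves no x_k with k > m when n is odd, and no x_k with
    k > n/2 when n is even.  If such polynomials p, evaluated at the y_k, lie in
    a subalgebra generated by central elements, then subtracting and inducting
    on the degree shows that this subalgebra is the center ([center_subalg]).
    For n odd that is all.

    Let n = 2 N and let s(z)^2 = sum_k x_k x_0^(k-1) z^k.  As D_j multiplies
    s^2 by x_0^j z^j and applies n - 2 j - z d/dz, it sends the coefficient s_r
    to x_0^j (N - r) s_(r-j) ([bracket_s]), which is 0 for r = N; the truncated
    square root involves x_0, ..., x_m only and is killed as well.  Hence
    D_j P = 0 and the value of P is central.  Conversely let p be killed by the
    D_j.  By the triangular system again, the gradients of p and P in the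
    variables x_k, k > m, are proportional.  The ratio is a polynomial q, because
    the derivative of P by x_(m+1) is prime to x_0: for x_0 = 0 it is a
    coefficient of (1 + x_1 z)^(-1/2) / 2, hence nonzero.  Now q is again killed
    by the D_j and has smaller degree, so it is a polynomial in x_0, ..., x_m and
    P; integrating with respect to P, so is p ([invariant_ring]).             *)

(** * Polynomial vector fields *)

Section PolynomialVectorFields.
Variables (f : fieldType) (N : nat).
Local Notation S := {mpoly f[N]}.
Implicit Types (p q : S) (v w : 'I_N -> S).

Lemma mpoly_alg_ind (Q : S -> Prop) :
    (forall c, Q c%:MP) -> (forall i, Q 'X_i) ->
    (forall p q, Q p -> Q q -> Q (p + q)) ->
    (forall p q, Q p -> Q q -> Q (p * q)) ->
  forall p, Q p.
Proof.
move=> QC QX QD QM; elim/mpolyind => [|c m p _ _ Qp].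
  by rewrite -(mpolyC0 _ f); apply: QC.
apply: (QD) => //; rewrite -mul_mpolyC; apply: (QM) => //.
have Qexp i e : Q ('X_i ^+ e).
  by elim: e => [|e IH]; [rewrite expr0 -mpolyC1; apply: QC|rewrite exprS; apply: QM].
rewrite mpolyXE_id; apply: big_ind => [||i _]; [|exact: QM|exact: Qexp].
by rewrite -mpolyC1; apply: QC.
Qed.

Definition vfield v p : S := \sum_k v k * p^`M(k).

Lemma vfield_linear v : linear (vfield v).
Proof.
move=> a p q; rewrite /vfield scaler_sumr -big_split; apply: eq_bigr => k _ /=.
by rewrite mderivD mderivZ mulrDr scalerAr.
Qed.
HB.instance Definition _ v :=
  GRing.isLinear.Build f S S *:%R (vfield v) (vfield_linear v).

Lemma vfieldM v p q : vfield v (p * q) = vfield v p * q + p * vfield v q.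
Proof.
rewrite /vfield mulr_suml mulr_sumr -big_split; apply: eq_bigr => k _ /=.
rewrite mderivM; ring.
Qed.

Lemma mderivXU (i k : 'I_N) : ('X_i : S)^`M(k) = (i == k)%:R.
Proof.
rewrite mderivX mnm1E; have [->|_] := eqVneq; last by rewrite scale0r.
have -> : (U_(k) - U_(k) = 0)%MM by apply/mnmP => j; rewrite mnmBE subnn mnm0E.
by rewrite mpolyX0 scale1r.
Qed.

Lemma vfieldX v i : vfield v 'X_i = v i.
Proof.
rewrite /vfield (bigD1 i) //= mderivXU eqxx mulr1 big1 ?addr0 // => k ki.
by rewrite mderivXU eq_sym (negbTE ki) mulr0.
Qed.

Lemma vfieldC v c : vfield v c%:MP = 0.
Proof. by rewrite /vfield big1 // => k _; rewrite mderivC mulr0. Qed.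

Lemma vfield_scale a v w p :
  (forall k, v k = a *: w k) -> vfield v p = a *: vfield w p.
Proof.
by move=> vw; rewrite /vfield scaler_sumr; apply: eq_bigr => k _; rewrite vw scalerAl.
Qed.

(** Partial derivatives do not quite preserve the invariants of a vector field:
    the commutator term is what has to vanish. *)
Lemma vfield_mderiv v k p :
  vfield v p^`M(k) = (vfield v p)^`M(k) - vfield (fun i => (v i)^`M(k)) p.
Proof.
rewrite /vfield raddf_sum -sumrB; apply: eq_bigr => i _ /=.
rewrite mderivM mderiv_comm; ring.
Qed.

Lemma vfield_comm v w p :
  vfield v (vfield w p) - vfield w (vfield v p) =
  vfield (fun k => vfield v (w k) - vfield w (v k)) p.
Proof.
have E a b : vfield a (vfield b p) =
    \sum_k vfield a (b k) * p^`M(k) + \sum_k b k * vfield a p^`M(k).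
  rewrite {1}/vfield -big_split /=.
  rewrite -[LHS]/(vfield a (\sum_k b k * p^`M(k))) raddf_sum /=.
  by apply: eq_bigr => k _; rewrite vfieldM.
rewrite !E.
have -> : \sum_k w k * vfield v p^`M(k) = \sum_k v k * vfield w p^`M(k).
  under eq_bigr do rewrite mulr_sumr; rewrite exchange_big /=.
  apply: eq_bigr => i _; rewrite mulr_sumr; apply: eq_bigr => j _.
  rewrite mderiv_comm; ring.
rewrite opprD addrACA subrr addr0 -sumrB; apply: eq_bigr => k _.
by rewrite mulrBl.
Qed.

Lemma msize_mderiv k p : p^`M(k) != 0 -> (msize p^`M(k) < msize p)%N.
Proof.
move=> nz; rewrite -(mlead_deg nz).
have := mlead_supp nz; rewrite mcoeff_msupp mcoeff_mderiv => c0.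
have : (mlead p^`M(k) + U_(k))%MM \in msupp p.
  by rewrite mcoeff_msupp; apply: contraNneq c0 => ->; rewrite mul0rn.
by move/msize_mdeg_lt; rewrite mdegD mdeg1 addn1.
Qed.

Lemma msize_vfield v p :
  (forall k, (msize (v k) <= 2)%N) -> (msize (vfield v p) <= msize p)%N.
Proof.
move=> Hv; rewrite /vfield; elim/big_ind: _ => [|q r Hq Hr|k _].
- by rewrite msize0.
- by apply: leq_trans (msizeD_le _ _) _; rewrite geq_max Hq.
have [->|v0] := eqVneq (v k) 0; first by rewrite mul0r msize0.
have [->|p0] := eqVneq p^`M(k) 0; first by rewrite mulr0 msize0.
rewrite msizeM //; move: (msize_mderiv p0) (Hv k).
by move: (msize p^`M(k)) (msize p) (msize (v k)) => a b c; lia.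
Qed.
End PolynomialVectorFields.

(** * Symbols of elements of a filtered algebra *)

Section Symbols.
Variables (f : fieldType) (U : algType f) (N : nat) (y : 'I_N -> U).
Local Notation S := {mpoly f[N]}.
Implicit Types (s t : seq 'I_N) (d e : nat) (u v w : U) (p q : S).

Definition word s : U := \prod_(i <- s) y i.
Definition monom s : S := \prod_(i <- s) 'X_i.

(** [has_symbol d u p]: u has degree at most d in the generators, and p is the
    image of u in degree d of the associated graded algebra, read off from some
    presentation of u by words.  That p depends on u alone is [symbol_inj]. *)
Inductive has_symbol : nat -> U -> S -> Prop :=
  | symbol_word s : has_symbol (size s) (word s) (monom s)
  | symbol_low d s : (size s < d)%N -> has_symbol d (word s) 0
  | symbol_zero d : has_symbol d 0 0
  | symbol_lin d a u v p q : has_symbol d u p -> has_symbol d v q ->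
      has_symbol d (a *: u + v) (a *: p + q).

Lemma word_cons i s : word (i :: s) = y i * word s.
Proof. exact: big_cons. Qed.

Lemma monom_cons i s : monom (i :: s) = 'X_i * monom s.
Proof. exact: big_cons. Qed.

Lemma symbolD d u v p q :
  has_symbol d u p -> has_symbol d v q -> has_symbol d (u + v) (p + q).
Proof. by move=> Hu Hv; rewrite -[u]scale1r -[p]scale1r; apply: symbol_lin. Qed.

Lemma symbolZ d a u p : has_symbol d u p -> has_symbol d (a *: u) (a *: p).
Proof.
move=> Hu; rewrite -[a *: u]addr0 -[a *: p]addr0.
exact/symbol_lin/symbol_zero.
Qed.

Lemma symbol_const a : has_symbol 0 (a%:A) (a%:MP).
Proof.
have := symbolZ a (symbol_word [::]).
by rewrite /word /monom !big_nil -mul_mpolyC mulr1.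
Qed.

Lemma symbol_gen i : has_symbol 1 (y i) 'X_i.
Proof. by have := symbol_word [:: i]; rewrite /word /monom !big_seq1. Qed.

Lemma symbol_raise d e u p : has_symbol d u p -> (d < e)%N -> has_symbol e u 0.
Proof.
elim=> {d u p} [s|d s sd|d|d a u v p q _ IHu _ IHv] de.
- exact: symbol_low.
- exact/symbol_low/(ltn_trans sd).
- exact: symbol_zero.
- by have := symbol_lin a (IHu de) (IHv de); rewrite scaler0 addr0.
Qed.

Lemma symbolM d e u v p q :
  has_symbol d u p -> has_symbol e v q -> has_symbol (d + e) (u * v) (p * q).
Proof.
move=> Hu Hv; elim: Hu => {d u p} [s|d s sd|d|d a u u' p p' _ IHu _ IHu'].
- elim: Hv => {e v q} [t|e t te|e|e a v v' q q' _ IHv _ IHv'].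
  + by rewrite /word /monom -!big_cat -size_cat; apply: symbol_word.
  + rewrite mulr0 /word -big_cat; apply: symbol_low.
    by rewrite size_cat ltn_add2l.
  + by rewrite !mulr0; apply: symbol_zero.
  + by rewrite !mulrDr -!scalerAr; apply: symbol_lin.
- rewrite mul0r; elim: Hv => {e v q} [t|e t te|e|e a v v' q q' _ IHv _ IHv'].
  + rewrite /word -big_cat; apply: symbol_low; rewrite size_cat; lia.
  + rewrite /word -big_cat; apply: symbol_low; rewrite size_cat; lia.
  + by rewrite mulr0; apply: symbol_zero.
  + by have := symbol_lin a IHv IHv'; rewrite scaler0 addr0 mulrDr -scalerAr.
- by rewrite !mul0r; apply: symbol_zero.
- by rewrite !mulrDl -!scalerAl; apply: symbol_lin.
Qed.

(** The monomial of a word depends only on the number of occurrences of each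
    letter, that is on the word up to permutation. *)
Lemma monom_mnm s : monom s = 'X_[[multinom count_mem i s | i < N]].
Proof.
elim: s => [|i s IH].
  rewrite /monom big_nil -mpolyX0; congr mpolyX.
rewrite monom_cons IH -mpolyXD; congr mpolyX.
by apply/mnmP => j; rewrite mnmDE !mnmE.
Qed.

Lemma symbol_homog d u p : has_symbol d u p -> p \is d.-homog.
Proof.
elim=> {d u p} [s|d s sd|d|d a u v p q _ IHu _ IHv].
- elim: s => [|i s IH]; first by rewrite /monom big_nil dhomog1.
  rewrite monom_cons /= -add1n dhomogM // dhomogX; exact/eqP/mdeg1.
- exact: dhomog0.
- exact: dhomog0.
- by rewrite dhomogD // dhomogZ.
Qed.

(** The ordered polynomial: mmap multiplies the generators of a monomial in
    increasing order of the indices, whether or not they commute. *)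
Definition ordered p : U := mmap (in_alg U) y p.

Lemma orderedZ a p : ordered (a *: p) = a *: ordered p.
Proof. by rewrite /ordered mmapZ /= mulr_algl. Qed.

Lemma orderedD p q : ordered (p + q) = ordered p + ordered q.
Proof. exact: mmapD. Qed.

(** The nondecreasing word with given multiplicities. *)
Definition mnm_word (m : 'X_{1..N}) : seq 'I_N :=
  flatten [seq nseq (m i) i | i <- index_enum 'I_N].

Lemma word_mnm m : word (mnm_word m) = mmap1 y m.
Proof.
rewrite /word /mnm_word big_flatten big_map /=.
by apply: eq_bigr => i _; rewrite big_nseq -Monoid.iteropE.
Qed.

Lemma count_mnm_word m i : count_mem i (mnm_word m) = m i.
Proof.
rewrite /mnm_word count_flatten -map_comp sumnE big_map /=.
rewrite (bigD1 i) //= count_nseq /= eqxx mul1n big1 ?addn0 // => j ji.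
by rewrite count_nseq /= (negbTE ji).
Qed.

(* B i j is the symbol of [y_i, y_j]: brackets of generators have degree at
   most one, as in an enveloping algebra. *)
Section Commutators.
Variable B : 'I_N -> 'I_N -> S.
Hypothesis yB : forall i j, has_symbol 1 (y i * y j - y j * y i) (B i j).

(** The bracket with y_i is a derivation which does not raise the degree, so it
    acts on symbols as the vector field with the same values on generators. *)
Lemma symbol_commutator i d u p : has_symbol d u p ->
  has_symbol d (y i * u - u * y i) (vfield (B i) p).
Proof.
have Hword s : has_symbol (size s) (y i * word s - word s * y i)
    (vfield (B i) (monom s)).
  elim: s => [|j s IH].
    rewrite /word /monom !big_nil mulr1 mul1r subrr -mpolyC1 vfieldC.
    exact: symbol_zero.
  rewrite word_cons monom_cons vfieldM vfieldX /=.
  have -> : y i * (y j * word s) - y j * word s * y i =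
      (y i * y j - y j * y i) * word s + y j * (y i * word s - word s * y i).
    by rewrite mulrBl mulrBr !mulrA addrA subrK.
  by rewrite -add1n; apply: symbolD; apply: symbolM => //;
     [apply: symbol_word|apply: symbol_gen].
elim=> {d u p} [s|d s sd|d|d a u v p q _ IHu _ IHv] //.
- by rewrite linear0; apply: symbol_raise (Hword s) sd.
- by rewrite linear0 mulr0 mul0r subrr; apply: symbol_zero.
- rewrite linearP mulrDr mulrDl -scalerAr -scalerAl.
  by rewrite opprD addrACA -scalerBr; apply: symbol_lin.
Qed.

(** Moving a letter to the front of a word costs a bracket, of smaller degree. *)
Lemma word_perm i s t : perm_eq (i :: s) t ->
  exists q, has_symbol (size s) (word (i :: s) - word t) q.
Proof.
elim: s i t => [|j s IH] i t st.
  have <- : [:: i] = t by apply: perm_small_eq (st); rewrite -(perm_size st).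
  by exists 0; rewrite subrr; apply: symbol_zero.
have it : i \in t by rewrite -(perm_mem st) mem_head.
case/splitPr: it st => t1 t2 st.
have {}st : perm_eq (j :: s) (t1 ++ t2).
  by rewrite -(perm_cons i) (perm_trans st) // perm_catC /= perm_cons perm_catC.
have [q Hq] := IH _ _ st.
have sz : (size t1 + size t2 = (size s).+1)%N by rewrite -size_cat -(perm_size st).
exists ('X_i * q + vfield (B i) (monom t1) * monom t2).
have -> : word [:: i, j & s] - word (t1 ++ i :: t2) =
    y i * (word (j :: s) - word (t1 ++ t2)) +
    (y i * word t1 - word t1 * y i) * word t2.
  have word_cat a b : word (a ++ b) = word a * word b by exact: big_cat.
  by rewrite !word_cat !(word_cons i) mulrBr mulrBl !mulrA addrA subrK.
apply: symbolD; first by rewrite /= -add1n; apply: symbolM => //; apply: symbol_gen.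
by rewrite /= -sz; apply: symbolM (symbol_word _); apply/symbol_commutator/symbol_word.
Qed.

(** The spanning half of the Poincare-Birkhoff-Witt theorem. *)
Lemma symbol_defect d u p : has_symbol d.+1 u p ->
  exists q, has_symbol d (u - ordered p) q.
Proof.
move: {-2}d.+1 (erefl d.+1) => d' d'E Hu; elim: Hu d'E => {d' u p}.
- case=> [|i s] //= [<-]; rewrite monom_mnm /ordered mmapX -word_mnm.
  apply: word_perm; apply/allP => j _ /=.
  by rewrite count_mnm_word mnmE.
- move=> d' s sd d'E; rewrite /ordered mmap0 subr0; subst d'.
  move: sd; rewrite ltnS leq_eqVlt => /orP[/eqP<-|sd].
    by exists (monom s); apply: symbol_word.
  by exists 0; apply: symbol_low.
- by move=> d' _; exists 0; rewrite /ordered mmap0 subr0; apply: symbol_zero.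
- move=> d' a u v p q _ IHu _ IHv d'E.
  have [r Hr] := IHu d'E; have [r' Hr'] := IHv d'E.
  exists (a *: r + r'); rewrite orderedD orderedZ opprD addrACA -scalerBr.
  exact: symbol_lin.
Qed.

Lemma symbol0 u p : has_symbol 0 u p -> u = ordered p.
Proof.
move: {-2}0%N (erefl 0%N) => d dE Hu; elim: Hu dE => {d u p} //.
- case=> // _; rewrite /word /monom !big_nil /ordered -mpolyC1 mmapC.
  by rewrite /= scale1r.
- by move=> d s sd d0; rewrite d0 in sd.
- by move=> d _; rewrite /ordered mmap0.
- by move=> d a u v p q _ IHu _ IHv d0; rewrite orderedD orderedZ -IHu // -IHv.
Qed.

End Commutators.

(* The independence half of the Poincare-Birkhoff-Witt theorem.  Here sigma u
   is u applied to 1 in a representation on S where y_i acts by multiplication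
   by x_i up to an operator that does not raise the degree, so that sigma u has
   top component the symbol of u. *)
Section Representation.
Variables (sigma : {linear U -> S}) (delta : 'I_N -> 'I_N -> S).
Hypothesis sigma1 : sigma 1 = 1.
Hypothesis sigmaM :
  forall i u, sigma (y i * u) = 'X_i * sigma u + vfield (delta i) (sigma u).
Hypothesis delta_size : forall i j, (msize (delta i j) <= 2)%N.

Lemma symbol_sigma d u p : has_symbol d u p -> (msize (sigma u - p) <= d)%N.
Proof.
have szM i q d0 : (msize q <= d0)%N -> (msize ('X_i * q : S) <= d0.+1)%N.
  have [->|q0] := eqVneq q 0; first by rewrite mulr0 msize0.
  have X0 : 'X_i != 0 :> S by rewrite -msize_poly_eq0 msizeX.
  by rewrite msizeM // msizeX mdeg1.
have szm s : (msize (monom s) <= (size s).+1)%N.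
  elim: s => [|i s IH]; first by rewrite /monom big_nil msize1.
  by rewrite monom_cons szM.
have szD p1 q1 d0 : (msize p1 <= d0)%N -> (msize q1 <= d0)%N ->
    (msize (p1 + q1 : S) <= d0)%N.
  by move=> H1 H2; apply: leq_trans (msizeD_le _ _) _; rewrite geq_max H1.
have Hs s : (msize (sigma (word s) - monom s) <= size s)%N.
  elim: s => [|i s IH].
    by rewrite /word /monom !big_nil sigma1 subrr msize0.
  rewrite word_cons monom_cons sigmaM addrAC -mulrBr.
  apply: (szD) => /=; first exact: szM.
  apply: leq_trans (msize_vfield _ _) _ => //.
  rewrite -[sigma _](subrK (monom s)); apply: szD (szm s).
  exact: leq_trans IH _.
elim=> {d u p} [s|d s sd|d|d a u v p q _ IHu _ IHv] //.
- rewrite subr0; apply: leq_trans sd.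
  by rewrite -[sigma _](subrK (monom s)); apply: szD (szm s); apply: leqW.
- by rewrite linear0 subr0 msize0.
- rewrite linearP opprD addrACA -scalerBr; apply: (szD) => //.
  exact: leq_trans (msizeZ_le _ _) _.
Qed.

Lemma symbol_inj d p : has_symbol d 0 p -> p = 0.
Proof.
move=> H; have := symbol_sigma H; rewrite linear0 sub0r msizeN.
have hp := symbol_homog H.
apply: contraTeq => p0; rewrite -ltnNge -(mlead_deg p0).
by rewrite (dhomog_mf hp (mlead_supp p0)).
Qed.

End Representation.
End Symbols.

(** * Endomorphisms, enveloping algebras and subalgebras *)

Section LinearEndomorphisms.
Variables (f : fieldType) (A : algType f).

(** The linear endomorphisms of A, as target of the universal property: they
    form an algebra without any assumption of finite dimension. *)
Record lend := Lend { lend_fun :> A -> A; lend_linear : linear lend_fun }.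

Lemma lend_eq (g h : lend) : g =1 h -> g = h.
Proof.
case: g h => [g Hg] [h Hh] /= /funext gh.
by case: _ / gh Hh => Hh; rewrite (Prop_irrelevance Hg Hh).
Qed.

HB.instance Definition _ := gen_eqMixin lend.
HB.instance Definition _ := gen_choiceMixin lend.

Lemma lend0_linear : linear (fun _ : A => 0 : A).
Proof. by move=> a x y; rewrite scaler0 addr0. Qed.
Lemma lendD_linear (g h : lend) : linear (fun x => g x + h x).
Proof. by move=> a x y; rewrite !lend_linear scalerDr addrACA. Qed.
Lemma lendZ_linear b (g : lend) : linear (fun x => b *: g x).
Proof.
by move=> a x y; rewrite lend_linear scalerDr !scalerA [b * a]mulrC.
Qed.
Lemma lend1_linear : linear (fun x : A => x).
Proof. by []. Qed.
Lemma lendM_linear (g h : lend) : linear (fun x => g (h x)).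
Proof. by move=> a x y; rewrite !lend_linear. Qed.

Definition lendD g h := Lend (lendD_linear g h).
Definition lendZ a g := Lend (lendZ_linear a g).
Definition lendM g h := Lend (lendM_linear g h).
Definition lendN g := lendZ (-1) g.

Lemma lendDA : associative lendD.
Proof. by move=> g h k; apply: lend_eq => x /=; rewrite addrA. Qed.
Lemma lendDC : commutative lendD.
Proof. by move=> g h; apply: lend_eq => x /=; rewrite addrC. Qed.
Lemma lend0D : left_id (Lend lend0_linear) lendD.
Proof. by move=> g; apply: lend_eq => x /=; rewrite add0r. Qed.
Lemma lendND : left_inverse (Lend lend0_linear) lendN lendD.
Proof. by move=> g; apply: lend_eq => x /=; rewrite scaleN1r addNr. Qed.
HB.instance Definition _ := GRing.isZmodule.Build lend lendDA lendDC lend0D lendND.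

Lemma lendMA : associative lendM.
Proof. by move=> g h k; apply: lend_eq. Qed.
Lemma lend1M : left_id (Lend lend1_linear) lendM.
Proof. by move=> g; apply: lend_eq. Qed.
Lemma lendM1 : right_id (Lend lend1_linear) lendM.
Proof. by move=> g; apply: lend_eq. Qed.
Lemma lendMDl : left_distributive lendM lendD.
Proof. by move=> g h k; apply: lend_eq. Qed.
Lemma lend_raddf (g : lend) x y : g (x + y) = g x + g y.
Proof. by have := lend_linear g 1 x y; rewrite !scale1r. Qed.
Lemma lendMDr : right_distributive lendM lendD.
Proof. by move=> g h k; apply: lend_eq => x /=; rewrite lend_raddf. Qed.
Lemma lend1_neq0 : Lend lend1_linear != Lend lend0_linear.
Proof.
by apply/eqP => /(congr1 (lend_fun^~ 1)) /= /eqP; rewrite oner_eq0.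
Qed.
HB.instance Definition _ := GRing.Zmodule_isNzRing.Build lend
  lendMA lend1M lendM1 lendMDl lendMDr lend1_neq0.

Lemma lendZA a b g : lendZ a (lendZ b g) = lendZ (a * b) g.
Proof. by apply: lend_eq => x /=; rewrite scalerA. Qed.
Lemma lend1Z : left_id 1 lendZ.
Proof. by move=> g; apply: lend_eq => x /=; rewrite scale1r. Qed.
Lemma lendZDr : right_distributive lendZ +%R.
Proof. by move=> a g h; apply: lend_eq => x /=; rewrite scalerDr. Qed.
Lemma lendZDl g : {morph lendZ^~ g : a b / a + b}.
Proof. by move=> a b; apply: lend_eq => x /=; rewrite scalerDl. Qed.
HB.instance Definition _ := GRing.Zmodule_isLmodule.Build f lend
  lendZA lend1Z lendZDr lendZDl.

Lemma lendZAl a (g h : lend) : a *: (g * h) = (a *: g) * h.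
Proof. by apply: lend_eq. Qed.
HB.instance Definition _ := GRing.Lmodule_isLalgebra.Build f lend lendZAl.

Lemma lendZAr a (g h : lend) : a *: (g * h) = g * (a *: h).
Proof.
apply: lend_eq => x /=.
have lend0 : g 0 = 0 by apply: (addIr (g 0)); rewrite -lend_raddf !add0r.
by have := lend_linear g a (h x) 0; rewrite lend0 !addr0.
Qed.
HB.instance Definition _ := GRing.Lalgebra_isAlgebra.Build f lend lendZAr.

End LinearEndomorphisms.

Section EnvelopingTheory.
Variables (f : fieldType) (L : lieAlgType f) (U : algType f).
Variable inc : {linear L -> U}.
Hypothesis U_env : is_enveloping inc.

(** U is generated by L: the universal property identifies U with the algebra
    of formal terms [env L], on which one can argue by structural induction. *)
Lemma enveloping_ind (Q : U -> Prop) :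
    (forall a, Q a%:A) -> (forall x, Q (inc x)) ->
    (forall u v, Q u -> Q v -> Q (u + v)) ->
    (forall u v, Q u -> Q v -> Q (u * v)) ->
  forall u, Q u.
Proof.
move=> QC QL QD QM u.
have [g gE _] := U_env.2 _ (@env_var f L) (@env_var_lie f L).
have [h hE _] := (@env_enveloping f L).2 _ _ U_env.1.
have [k _ kU] := U_env.2 _ _ U_env.1.
have <- : h (g u) = u.
  transitivity (k u); last by rewrite -(kU idfun).
  by apply: (kU (h \o g)) => x /=; rewrite gE hE.
elim/quotW: (g u); elim=> [x|a|s IHs t IHt|s IHs t IHt].
- by rewrite hE.
- have -> : (\pi_(env L) (Cst L a))%qT = a%:A.
    by rewrite -[RHS]/(env_mul (env_cst L a) (env_cst L 1)) -env_cstM mulr1.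
  by rewrite linearZ rmorph1; apply: QC.
- by rewrite env_piD (rmorphD h); apply: QD.
- by rewrite env_piM (rmorphM h); apply: QM.
Qed.

Lemma centerP u : in_center u <-> forall x, inc x * u = u * inc x.
Proof.
split=> [Hu x|Hu v]; first by rewrite Hu.
elim/enveloping_ind: v => [a|x|v w Hv Hw|v w Hv Hw].
- by rewrite /GRing.comm mulr_algl mulr_algr.
- by rewrite /GRing.comm Hu.
- exact: commrD.
- exact: commrM.
Qed.

End EnvelopingTheory.

Section Subalgebras.
Variables (f : fieldType) (U : algType f) (G : seq U).

Lemma in_subalgD u v : in_subalg G u -> in_subalg G v -> in_subalg G (u + v).
Proof.
move=> Hu Hv S SC GS; rewrite -[u]scale1r.
by case: SC (Hu S SC GS) (Hv S SC GS) => _ lin _; apply: lin.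
Qed.

Lemma in_subalgM u v : in_subalg G u -> in_subalg G v -> in_subalg G (u * v).
Proof.
by move=> Hu Hv S SC GS; case: SC (Hu S SC GS) (Hv S SC GS) => _ _; apply.
Qed.

Lemma in_subalg1 : in_subalg G 1.
Proof. by move=> S []. Qed.

Lemma in_subalgZ a u : in_subalg G u -> in_subalg G (a *: u).
Proof.
move=> Hu; have H0 : in_subalg G 0.
  move=> S SC GS; case: (SC) => S1 lin _.
  by have := lin (-1) _ _ S1 S1; rewrite scaleN1r addNr.
move=> S SC GS; rewrite -[_ *: _]addr0.
by case: SC (Hu S SC GS) (H0 S SC GS) => _ lin _; apply: lin.
Qed.

Lemma in_subalg0 : in_subalg G 0.
Proof. by rewrite -(scale0r 1); apply/in_subalgZ/in_subalg1. Qed.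

Lemma in_subalgX u e : in_subalg G u -> in_subalg G (u ^+ e).
Proof.
by move=> Hu; elim: e => [|e IH]; [apply: in_subalg1|rewrite exprS; apply: in_subalgM].
Qed.

Lemma in_subalg_gen u : u \in G -> in_subalg G u.
Proof. by move=> uG S _; apply. Qed.

Lemma in_subalg_sum (I : eqType) (r : seq I) (F : I -> U) :
  (forall i, i \in r -> in_subalg G (F i)) -> in_subalg G (\sum_(i <- r) F i).
Proof.
move=> H; rewrite big_seq; elim/big_ind: _ => //; first exact: in_subalg0.
exact: in_subalgD.
Qed.

Lemma in_subalg_prod (I : finType) (F : I -> U) :
  (forall i, in_subalg G (F i)) -> in_subalg G (\prod_i F i).
Proof.
by move=> H; elim/big_ind: _ => //; [exact: in_subalg1|exact: in_subalgM].
Qed.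

Lemma subalg_central u :
  (forall g, g \in G -> in_center g) -> in_subalg G u -> in_center u.
Proof.
move=> HG /(_ [pred v | `[< in_center v >]]) H.
apply/asboolP/H => [|g /HG Hg]; last exact/asboolP.
split=> [|a v w|v w]; rewrite ?inE.
- by apply/asboolP => v; apply/commr_sym/commr1.
- move=> /asboolP Hv /asboolP Hw; apply/asboolP => x.
  apply/commr_sym/commrD/commr_sym/Hw.
  by rewrite /GRing.comm -scalerAr -scalerAl Hv.
- move=> /asboolP Hv /asboolP Hw; apply/asboolP => x.
  exact/commr_sym/commrM/commr_sym/Hw/commr_sym/Hv.
Qed.

End Subalgebras.

(** * The enveloping algebra of a truncated Witt algebra *)

Section Variables.
Variables (f : fieldType) (N : nat).
Local Notation S := {mpoly f[N]}.

Definition var (i : nat) : S := if insub i is Some i' then 'X_i' else 0.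

Lemma varE (i : 'I_N) : var i = 'X_i.
Proof. by rewrite /var valK. Qed.

Lemma var_lt i (iN : (i < N)%N) : var i = 'X_(Ordinal iN).
Proof. by rewrite -varE. Qed.

Lemma msize_var i : (msize (var i) <= 2)%N.
Proof.
rewrite /var; case: insub => [j|]; last by rewrite msize0.
by rewrite msizeX mdeg1.
Qed.

(** The vector field x_k |-> c_k x_(k-j), with x_i = 0 for i < 0. *)
Definition shift (c : nat -> f) (j : nat) (k : 'I_N) : S :=
  if (j <= k)%N then c k *: var (k - j) else 0.

Lemma msize_shift c j k : (msize (shift c j k) <= 2)%N.
Proof.
rewrite /shift; case: ifP => _; last by rewrite msize0.
by apply: leq_trans (msizeZ_le _ _) (msize_var _).
Qed.

Lemma vfield_shift_var c j k : (k < N)%N ->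
  vfield (shift c j) (var k) = if (j <= k)%N then c k *: var (k - j) else 0.
Proof. by move=> kN; rewrite var_lt vfieldX. Qed.

Lemma vfield_shift_shift c c' i j k :
  vfield (shift c i) (shift c' j k) =
  if (i + j <= k)%N then (c' k * c (k - j)%N) *: var (k - (i + j)) else 0.
Proof.
rewrite {2}/shift; case: leqP => [jk|kj]; last first.
  by rewrite linear0 leqNgt (leq_trans kj) // leq_addl.
rewrite linearZ /= vfield_shift_var ?(leq_ltn_trans (leq_subr _ _)) //.
rewrite leq_subRL // addnC; case: leqP => _; last by rewrite scaler0.
by rewrite scalerA -subnDA addnC.
Qed.

End Variables.

Section TruncatedWitt.
Variables (f : fieldType) (m n : nat).
Hypothesis mn : (m < n)%N.
Local Notation D := (n.+1 - m.+1)%N.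
Local Notation L := (Lquo f m.+1 n.+1).
Local Notation S := {mpoly f[D]}.
Local Notation l := (Lquo_l f m.+1 n.+1).

Lemma Lquo_l_delta (r : 'I_D) : l (m.+1 + r) = delta_mx 0 r.
Proof. by apply/rowP=> j; rewrite !mxE /W1_l eqSS eqn_add2l. Qed.

Lemma Lquo_l_eq0 j : (n < j)%N -> l j = 0.
Proof.
move=> nj; apply/rowP => r; rewrite !mxE /W1_l [_ == _](_ : _ = false) //.
by have := ltn_ord r; lia.
Qed.

Lemma Lquo_ind (Q : L -> Prop) :
    Q 0 -> (forall a x y, Q x -> Q y -> Q (a *: x + y)) ->
    (forall j, (m < j <= n)%N -> Q (l j)) -> forall x, Q x.
Proof.
move=> Q0 Qlin Ql x; rewrite [x]row_sum_delta.
elim/big_ind: _ => // [u v Qu Qv|r _].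
  by rewrite -[u]scale1r; apply: Qlin.
rewrite -[_ *: _]addr0 -Lquo_l_delta; apply: Qlin => //; apply: Ql.
by have := ltn_ord r; lia.
Qed.

(** In terms of x_k = l_(n-k), the pre-Lie product l_j . l_(n-k) has coefficient
    n - k, and the bracket [l_j, l_(n-k)] has coefficient n - k - j. *)
Definition prelie_coef (k : nat) : f := n%:R - k%:R.
Definition bracket_coef (j k : nat) : f := n%:R - k%:R - j%:R.

(** The case j > n stands for l_j = 0: then no x_k has k >= j, and the vector
    field vanishes too. *)
Definition prelie_fun j (p : S) : S :=
  (if (j <= n)%N then var f D (n - j) else 0) * p +
  vfield (shift prelie_coef j) p.

Lemma prelie_linear j : linear (prelie_fun j).
Proof.
move=> a p q; rewrite /prelie_fun linearP mulrDr -scalerAr scalerDr.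
by rewrite addrACA.
Qed.
Definition prelie j : lend S := Lend (prelie_linear j).

(** The identity behind the representation: with c_k = n - k, the commutator of
    the shifts by i and j has coefficient c_k (c_(k-j) - c_(k-i)) = c_k (j - i). *)
Lemma prelie_commutator i j : (m < i <= n)%N -> (m < j <= n)%N ->
  prelie i * prelie j - prelie j * prelie i = (j%:R - i%:R) *: prelie (i + j)%N.
Proof.
move=> /andP[mi iN] /andP[mj jN].
apply: lend_eq => p.
rewrite -[LHS]/(prelie_fun i (prelie_fun j p) + -1 *: prelie_fun j (prelie_fun i p)).
rewrite -[RHS]/(_ *: prelie_fun (i + j) p).
rewrite /prelie_fun iN jN scaleN1r !linearD /= !vfieldM.
have -> (a b x y s t xs yt : S) :
    a * (b * p + x) + (s * p + b * y + xs) +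
    (- (b * (a * p + y)) + (- (t * p + a * x) - yt))
    = (s - t) * p + (xs - yt) by ring.
rewrite vfield_comm scalerAl; congr (_ * _ + _).
  rewrite !vfield_shift_var; try lia.
  rewrite !leq_subRL // ![(j + i)%N]addnC; case: leqP => ijn; last first.
    by rewrite subr0 scaler0.
  rewrite -!subnDA [(j + i)%N]addnC -scalerBl /prelie_coef !natrB //.
  by congr (_ *: _); ring.
apply: vfield_scale => k; rewrite !vfield_shift_shift [(j + i)%N]addnC /shift.
case: leqP => ijk; last by rewrite subr0 scaler0.
rewrite -scalerBl scalerA /prelie_coef !natrB; try lia.
by congr (_ *: _); ring.
Qed.

Definition prelie_rep_fun (x : L) : lend S := \sum_r x 0 r *: prelie (m.+1 + r)%N.

Lemma prelie_rep_linear : linear prelie_rep_fun.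
Proof.
move=> a x y; rewrite /prelie_rep_fun scaler_sumr -big_split.
by apply: eq_bigr => r _ /=; rewrite !mxE scalerDl scalerA.
Qed.
HB.instance Definition _ :=
  GRing.isLinear.Build f L (lend S) *:%R prelie_rep_fun prelie_rep_linear.
Definition prelie_rep : {linear L -> lend S} := prelie_rep_fun.

Lemma prelie_rep_l j : (m < j)%N -> prelie_rep (l j) = prelie j.
Proof.
move=> mj; rewrite /prelie_rep /= /prelie_rep_fun.
have [jn|nj] := leqP j n; last first.
  rewrite big1 => [|r _]; last by rewrite Lquo_l_eq0 // mxE scale0r.
  apply: lend_eq => p; rewrite /= /prelie_fun leqNgt nj mul0r add0r /vfield big1 //.
  move=> k _; rewrite /shift ifF ?mul0r //.
  by have := ltn_ord k; lia.
have jD : (j - m.+1 < D)%N by lia.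
rewrite (bigD1 (Ordinal jD)) //= big1 ?addr0 => [|r].
  by rewrite mxE /= /W1_l subnKC // eqxx scale1r.
rewrite -val_eqE /= => rj; rewrite mxE /W1_l [_ == _](_ : _ = false) ?scale0r //.
by lia.
Qed.

Lemma prelie_rep_lie : is_lie_morphism prelie_rep.
Proof.
move=> x y; elim/Lquo_ind: x => [|a x x' Hx Hx'|i Hi].
- have -> : lie (0 : L) y = 0.
    by have := lie_linearl y (-1) 0 0; rewrite scaler0 addr0 scaleN1r addNr.
  by rewrite !linear0 mul0r mulr0 subrr.
- rewrite [lie _ _](lie_linearl y) !linearP Hx Hx' mulrDl mulrDr.
  by rewrite -scalerAl -scalerAr opprD addrACA -scalerBr.
elim/Lquo_ind: y => [|a y y' Hy Hy'|j Hj].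
- have -> : lie (l i) (0 : L) = 0.
    by have := lie_linearr (l i) (-1) 0 0; rewrite scaler0 addr0 scaleN1r addNr.
  by rewrite !linear0 mul0r mulr0 subrr.
- rewrite [lie _ _](lie_linearr (l i)) !linearP Hy Hy' mulrDl mulrDr.
  by rewrite -scalerAl -scalerAr opprD addrACA -scalerBr.
have /andP[mi iN] := Hi; have /andP[mj jN] := Hj.
rewrite lie_Lquo_l // 1?ltnW // linearZ !prelie_rep_l ?prelie_commutator //.
by lia.
Qed.

Section Enveloping.
Variables (U : algType f) (inc : {linear L -> U}).
Hypothesis U_env : is_enveloping inc.

(** Indexing by k = n - weight makes the brackets independent of the cut-off m:
    [l_j, y_k] is a multiple of y_(k-j). *)
Definition gen (k : nat) : U := inc (l (n - k)).
Definition ogen (k : 'I_D) : U := gen k.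
Local Notation symb := (has_symbol ogen).

Lemma l_commutator i j : (m < i)%N -> (m < j)%N ->
  inc (l i) * inc (l j) - inc (l j) * inc (l i) =
  (j%:R - i%:R) *: inc (l (i + j)).
Proof. by move=> mi mj; rewrite -U_env.1 lie_Lquo_l ?linearZ // ltnS ltnW. Qed.

Lemma gen_commutator j k : (m < j <= n)%N -> (k < D)%N ->
  inc (l j) * gen k - gen k * inc (l j) =
  if (j <= k)%N then bracket_coef j k *: gen (k - j) else 0.
Proof.
move=> /andP[mj jn] kD; rewrite l_commutator //; last by lia.
case: leqP => jk; last by rewrite Lquo_l_eq0 ?linear0 ?scaler0 //; lia.
rewrite /gen /bracket_coef natrB; last by lia.
by congr (_ *: inc (l _)); lia.
Qed.

Lemma ogen_commutator (i j : 'I_D) :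
  symb 1 (ogen i * ogen j - ogen j * ogen i)
    (shift (bracket_coef (n - i)) (n - i) j).
Proof.
rewrite {1 4}/ogen {1 2}/gen gen_commutator //; last by have := ltn_ord i; lia.
rewrite /shift; case: leqP => ij; last exact: symbol_zero.
apply: symbolZ; have kD : (j - (n - i) < D)%N by have := ltn_ord j; lia.
by rewrite var_lt; apply: (symbol_gen ogen (Ordinal kD)).
Qed.

Lemma symbol_exists u : exists d p, symb d u p.
Proof.
elim/(enveloping_ind U_env): u =>
  [a|x|u v [d [p Hu]] [e [q Hv]]|u v [d [p Hu]] [e [q Hv]]].
- by exists 0%N, a%:MP; apply: symbol_const.
- exists 1%N; elim/Lquo_ind: x => [|a x y [p Hx] [q Hy]|j Hj].
  + by exists 0; rewrite linear0; apply: symbol_zero.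
  + by exists (a *: p + q); rewrite linearP; apply: symbol_lin.
  have kD : (n - j < D)%N by lia.
  exists 'X_(Ordinal kD); have := symbol_gen ogen (Ordinal kD).
  by rewrite /ogen /gen /= subKn //; case/andP: Hj.
- exists (d + e).+1, (0 + 0); apply: symbolD.
    by apply: symbol_raise Hu _; rewrite ltnS leq_addr.
  by apply: symbol_raise Hv _; rewrite ltnS leq_addl.
- by exists (d + e)%N, (p * q); apply: symbolM.
Qed.

Lemma prelie_symbol_inj d p : symb d 0 p -> p = 0.
Proof.
have [g gE _] := U_env.2 _ prelie_rep prelie_rep_lie.
have slin : linear (fun u => g u 1) by move=> a u v; rewrite linearP.
pose sigma : {linear U -> S} := HB.pack (fun u => g u 1)
  (GRing.isLinear.Build f U S *:%R _ slin).
apply: (symbol_inj (sigma := sigma)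
         (delta := fun i : 'I_D => shift prelie_coef (n - i))) => //=.
- by rewrite rmorph1.
- move=> i u; rewrite rmorphM /= /ogen /gen gE prelie_rep_l; last first.
    by have := ltn_ord i; lia.
  rewrite /= /prelie_fun leq_subr subKn ?varE //.
  by have := ltn_ord i; lia.
- by move=> i j; apply: msize_shift.
Qed.

(** Induction on the degree: the symbol p of a central u is killed by the
    brackets, so its ordered value lies in the subalgebra by hypothesis; that
    value is central with the same symbol, and the difference with u has smaller
    degree. *)
Lemma center_subalg (G : seq U) :
    (forall g, g \in G -> in_center g) ->
    (forall p, (forall j, (m < j <= n)%N -> vfield (shift (bracket_coef j) j) p = 0) ->
       in_subalg G (ordered ogen p)) ->
  forall u, in_center u -> in_subalg G u.
Proof.
move=> Gc Hp u; have [d [p Hu]] := symbol_exists u.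
have central_symbol e v q : symb e v q -> in_center v -> in_subalg G (ordered ogen q).
  move=> Hv vc; apply: Hp => j Hj.
  have iD : (n - j < D)%N by lia.
  have := symbol_commutator ogen_commutator (Ordinal iD) Hv.
  rewrite vc subrr /= subKn; last by lia.
  exact: prelie_symbol_inj.
elim: d u p Hu => [|d IH] u p Hu uc.
  by rewrite (symbol0 Hu); apply: central_symbol Hu uc.
have Gp := central_symbol _ _ _ Hu uc.
have [q Hq] := symbol_defect ogen_commutator Hu.
rewrite -[u](subrK (ordered ogen p)); apply: in_subalgD (Gp).
apply: IH Hq _ => v.
by apply/commr_sym/commrB/commr_sym/(subalg_central Gc Gp); apply/commr_sym/uc.
Qed.

End Enveloping.
End TruncatedWitt.

(** * Products and square roots of power series *)

Section Convolution.
Variable R : comNzRingType.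
Implicit Types s e u v : nat -> R.

(** The product of the power series with coefficients u and v. *)
Definition conv u v r : R := \sum_(i < r.+1) u i * v (r - i)%N.

Lemma conv_cancel B s e : s 0%N = 1 ->
  (forall r, (r <= B)%N -> conv s e r = 0) -> forall r, (r <= B)%N -> e r = 0.
Proof.
move=> s0 se; elim/ltn_ind => r IH rB.
have := se r rB; rewrite /conv big_ord_recl subn0 s0 mul1r big1 ?addr0 //.
move=> i _; rewrite IH ?mulr0 //= /bump leq0n /=; have := ltn_ord i; lia.
Qed.

Lemma conv_rev (u v : nat -> R) (c : nat -> nat -> R) r :
  \sum_(i < r.+1) c i (r - i)%N * (u i * v (r - i)%N) =
  \sum_(i < r.+1) c (r - i)%N i * (u (r - i)%N * v i).
Proof.
rewrite (reindex_inj rev_ord_inj); apply: eq_bigr => i _ /=.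
by rewrite subSS subKn // -ltnS.
Qed.

Lemma convC u v r : conv u v r = conv v u r.
Proof.
have := conv_rev u v (fun _ _ => 1) r.
under eq_bigr do rewrite mul1r; rewrite /conv => ->.
by apply: eq_bigr => i _; rewrite mul1r mulrC.
Qed.

Lemma convBr s u v r : conv s (fun i => u i - v i) r = conv s u r - conv s v r.
Proof. by rewrite /conv -sumrB; apply: eq_bigr => i _; rewrite mulrBr. Qed.

Lemma conv_shift s u c j r :
  conv s (fun i => if (j <= i)%N then c * u (i - j)%N else 0) r =
  if (j <= r)%N then c * conv s u (r - j) else 0.
Proof.
case: leqP => jr; last first.
  rewrite /conv big1 // => i _.
  by rewrite leqNgt (leq_ltn_trans (leq_subr _ _) jr) mulr0.
rewrite /conv mulr_sumr.
rewrite (big_ord_widen_cond r.+1 xpredT (fun i => c * (s i * u (r - j - i)%N))).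
  rewrite [RHS]big_mkcond /=; apply: eq_bigr => i _; have := ltn_ord i => ir.
  have -> : (j <= r - i)%N = (i < (r - j).+1)%N by lia.
  by case: ifP => // _; rewrite ?mulr0 // mulrCA subnAC.
by rewrite ltnS leq_subr.
Qed.

(** The coefficient of z^r in 2 s (z s') = z (s^2)'. *)
Lemma conv_weight s r :
  \sum_(i < r.+1) (i%:R *+ 2) * (s i * s (r - i)%N) = r%:R * conv s s r.
Proof.
transitivity (\sum_(i < r.+1) i%:R * (s i * s (r - i)%N) +
              \sum_(i < r.+1) (r - i)%:R * (s i * s (r - i)%N)).
  have -> := conv_rev s s (fun _ b => b%:R) r.
  by rewrite -big_split; apply: eq_bigr => i _ /=; ring.
rewrite -big_split /conv mulr_sumr; apply: eq_bigr => i _ /=.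
by rewrite -mulrDl -natrD subnKC // -ltnS.
Qed.

Lemma conv_deriv (d : R -> R) s r :
    (forall x y, d (x + y) = d x + d y) ->
    (forall x y, d (x * y) = d x * y + x * d y) ->
  d (conv s s r) = conv s (fun i => d (s i)) r *+ 2.
Proof.
move=> dD dM; have d0 : d 0 = 0 by apply: (addrI (d 0)); rewrite -dD !addr0.
rewrite /conv (big_morph d dD d0) mulr2n.
under eq_bigr do rewrite dM; rewrite big_split /=; congr (_ + _).
transitivity (conv (fun i => d (s i)) s r) => //; exact: convC.
Qed.

End Convolution.

(** Recursion on all the previous values, as needed for the coefficients of
    inverses and square roots of power series. *)
Lemma sequence_rec (T : Type) (F : seq T -> T) :
  exists s : nat -> T, forall r, s r = F (mkseq s r).
Proof.
pose l r := iter r (fun t => rcons t (F t)) [::].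
exists (fun r => F (l r)) => r; congr F.
elim: r => [|r IH] //=; rewrite {1}IH -[in RHS]addn1.
by rewrite /mkseq iotaD map_cat cats1 add0n.
Qed.

Lemma conv_inv_exists (R : comNzRingType) (s : nat -> R) : s 0%N = 1 ->
  exists h : nat -> R, forall r, conv s h r = (r == 0%N)%:R.
Proof.
move=> s0.
have [h hE] := sequence_rec (fun t : seq R => let r := size t in
  (r == 0%N)%:R - \sum_(i < r) s i.+1 * t`_(r - i.+1)).
exists h => r; rewrite /conv big_ord_recl s0 mul1r subn0 hE size_mkseq.
rewrite [X in _ + X](_ : _ = \sum_(i < r) s i.+1 * (mkseq h r)`_(r - i.+1)).
  exact: subrK.
by apply: eq_bigr => i _; rewrite nth_mkseq //; have := ltn_ord i; lia.
Qed.

Section SeriesExistence.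
Variables (f : fieldType) (two_neq0 : 2%:R != 0 :> f) (R : comAlgType f).

Lemma conv_sqrt_exists (a : nat -> R) : a 0%N = 1 ->
  exists2 s, s 0%N = 1 & forall r, conv s s r = a r.
Proof.
move=> a0.
have [s sE] := sequence_rec (fun t : seq R => let r := size t in
  if r is q.+1 then 2%:R^-1 *: (a r - \sum_(i < q) t`_i.+1 * t`_(q - i)) else 1).
have s0 : s 0%N = 1 by rewrite sE.
exists s => // -[|r]; first by rewrite /conv big_ord1 s0 a0 mulr1.
rewrite /conv big_ord_recl big_ord_recr /= s0 mul1r subn0.
rewrite /bump /= add1n subnn s0 mulr1 addrCA -mulr2n; have -> := sE r.+1.
rewrite size_mkseq -scaler_nat scalerA divff // scale1r addrC.
rewrite [X in _ + X](_ : _ =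
  \sum_(i < r) (mkseq s r.+1)`_i.+1 * (mkseq s r.+1)`_(r - i)).
  exact: subrK.
by apply: eq_bigr => i _; rewrite add1n subSS !nth_mkseq //; have := ltn_ord i; lia.
Qed.

End SeriesExistence.

(** * The series (1 + z)^(-1/2) *)

Section CharZero.
Variables (f : fieldType) (f_char0 : [pchar f] =i pred0).

Lemma natf_neq0 k : (0 < k)%N -> k%:R != 0 :> f.
Proof. by move=> k0; rewrite (pcharf0P f).1 // -lt0n. Qed.

Lemma natf_inj a b : a%:R = b%:R :> f -> a = b.
Proof.
wlog ab : a b / (a <= b)%N => [H E|E].
  by case/orP: (leq_total a b) => ab; [|apply/esym]; apply: H.
apply/eqP; rewrite eqn_leq ab -subn_eq0 -leqn0 leqNgt; apply/negP => ba.
by have /eqP := natf_neq0 ba; rewrite natrB // E subrr.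
Qed.

(** If s^2 = 1 + z and s c = 1, then 2 (1 + z) c' = - c, which gives the
    recurrence 2 (r + 1) c_(r+1) = - (2 r + 1) c_r. *)
Lemma inv_sqrt_coef_neq0 B (s c : nat -> f) :
    (forall r, (r <= B)%N -> conv s s r = (r <= 1)%N%:R) ->
    (forall r, (r <= B)%N -> conv s c r = (r == 0%N)%:R) ->
  forall r, (r <= B)%N -> c r != 0.
Proof.
move=> ss sc.
(* The series are only known up to z^B: they are replaced by polynomials, and
   the identities hold up to multiples of z^(B+1), hence of z^B after
   differentiation. *)
pose P (u : nat -> f) := \poly_(i < B.+1) u i.
have PM u v (g : {poly f}) : (forall r, (r <= B)%N -> conv u v r = g`_r) ->
    exists k, P u * P v = g + k * 'X^(B.+1).
  move=> uv; exists (drop_poly B.+1 (P u * P v - g)).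
  rewrite -[LHS](subrK g) -[X in X + g](poly_take_drop B.+1).
  rewrite [take_poly _ _](_ : _ = 0); first by rewrite add0r addrC.
  apply/polyP => r; rewrite coef_take_poly coef0; case: ltnP => // rB.
  rewrite coefB coefM -uv // /conv; apply/eqP; rewrite subr_eq0; apply/eqP.
  apply: eq_bigr => i _; rewrite !coef_poly.
  by have := ltn_ord i => ir; rewrite !ifT //; lia.
have [g gE] : exists k, P s * P s = 1 + 'X + k * 'X^(B.+1).
  apply: PM => r rB; rewrite ss // coefD coef1 coefX.
  by case: r {rB} => [|[|r]] //=; rewrite ?addr0 ?add0r.
have [h hE] : exists k, P s * P c = 1 + k * 'X^(B.+1).
  by apply: PM => r rB; rewrite sc // coef1.
have gD := congr1 deriv gE; have hD := congr1 deriv hE.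
have XD : ('X^(B.+1))^`() = B.+1%:R * 'X^B :> {poly f}.
  by rewrite derivXn mulr_natl.
rewrite !derivD !derivM derivX XD -[1]/(1%:P) derivC in gD.
rewrite !derivD !derivM XD -[1]/(1%:P) derivC in hD.
have ode : exists k, P c + (P c)^`() *+ 2 + 'X * (P c)^`() *+ 2 = k * 'X^B.
  move: gE hE gD hD; rewrite exprS.
  move: (P s) (P c) (P s)^`() (P c)^`() g^`() h^`() => S C S' C' g' h' gE hE gD hD.
  have E1 : 2%:R * S * (S' * C + S * C') =
      (2%:R * S * (h' * 'X + h * B.+1%:R)) * 'X^B by rewrite hD; ring.
  have E2 : 2%:R * S * (S' * C + S * C') =
      (S' * S + S * S') * C + 2%:R * (S * S) * C' by ring.
  exists (2%:R * S * (h' * 'X + h * B.+1%:R)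
     - (g' * 'X + g * B.+1%:R) * C - 2%:R * g * 'X * C').
  by rewrite !mulrBl -E1 E2 gE gD; ring.
have rec r : (r < B)%N -> (r%:R *+ 2 + 1) * c r = - (r.+1%:R * c r.+1 *+ 2).
  move=> rB; case: ode => k kE; have := congr1 (fun p : {poly f} => p`_r) kE.
  rewrite coefMXn rB !coefD coef_deriv.
  have -> : ('X * (P c)^`())`_r = c r *+ r.
    case: r rB => [|r] rB; first by rewrite coefXM mulr0n.
    by rewrite coefXM /= coef_deriv coef_poly ltnS ltnW.
  rewrite /P !coef_poly !ltnS rB (ltnW rB) => E.
  apply/eqP; rewrite -subr_eq0 opprK -[X in _ == X]E -!(mulr_natl (c _)).
  by apply/eqP; ring.
elim=> [|r IH] rB.
  have := sc 0%N rB; rewrite /conv big_ord1 => E.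
  by apply: contraTneq isT => c0; move/eqP: E; rewrite c0 mulr0 eq_sym oner_eq0.
apply: contraNneq (IH (ltnW rB)) => c0.
have /eqP := rec r rB; rewrite c0 mulr0 mul0rn oppr0 mulf_eq0 => /orP[|//].
have -> : r%:R *+ 2 + 1 = (r * 2 + 1)%:R :> f by rewrite natrD natrM mulr_natr.
by rewrite (negbTE (natf_neq0 _)) // addn1.
Qed.
End CharZero.

(** * Derivatives of the generating function *)

Section Invariants.
Variables (f : fieldType) (f_char0 : [pchar f] =i pred0) (M : nat).
Local Notation S := {mpoly f[M]}.
Local Notation z := (var f M).
Implicit Types (p q c : S) (n j k : nat).

Definition bracket_field n j : S -> S := vfield (shift (bracket_coef f n j) j).

Lemma bracket_field_linear n j : linear (bracket_field n j).
Proof. exact: vfield_linear. Qed.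
HB.instance Definition _ n j :=
  GRing.isLinear.Build f S S *:%R (bracket_field n j) (bracket_field_linear n j).

Lemma bracket_fieldM n j p q : bracket_field n j (p * q) =
  bracket_field n j p * q + p * bracket_field n j q.
Proof. exact: vfieldM. Qed.

Lemma bracket_field_var n j k : (k < M)%N ->
  bracket_field n j (z k) =
  if (j <= k)%N then bracket_coef f n j k *: z (k - j) else 0.
Proof. exact: vfield_shift_var. Qed.

Lemma derivX0 (d : S -> S) p e :
    (forall x y, d (x * y) = d x * y + x * d y) -> d p = 0 -> d 1 = 0 ->
  d (p ^+ e) = 0.
Proof.
move=> dM dp d1; elim: e => [|e IH]; first by rewrite expr0.
by rewrite exprS dM dp IH mul0r mulr0 addr0.
Qed.

Lemma bracket_field1 n j : bracket_field n j 1 = 0.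
Proof. by rewrite -mpolyC1; apply: vfieldC. Qed.

Lemma bracket_field_expz0 n j e : (0 < j)%N -> (0 < M)%N ->
  bracket_field n j (z 0%N ^+ e) = 0.
Proof.
move=> j0 M0; apply: derivX0 (bracket_field1 n j); first exact: bracket_fieldM.
by rewrite bracket_field_var // leqNgt j0.
Qed.

Lemma mderiv1 (k : 'I_M) : (1 : S)^`M(k) = 0.
Proof. by rewrite -mpolyC1 mderivC. Qed.

Lemma mderiv_var (k : 'I_M) i : (i < M)%N -> (z i)^`M(k) = (i == k)%:R.
Proof. by move=> iM; rewrite var_lt mderivXU -val_eqE. Qed.

Lemma mderiv_expz0 (k : 'I_M) e : (0 < k)%N -> (z 0%N ^+ e)^`M(k) = 0.
Proof.
move=> k0; apply: (derivX0 (d := mderiv k)) (mderiv1 k); first exact: mderivM.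
rewrite mderiv_var ?(leq_ltn_trans _ (ltn_ord k)) //.
by rewrite eq_sym gtn_eqF.
Qed.

(** The coefficients x_j x_0^(j-1) of the radicand, without division by x_0. *)
Definition rad (j : nat) : S := if j is i.+1 then z i.+1 * z 0%N ^+ i else 1.

Lemma mderiv_rad (k : 'I_M) r : (0 < k)%N -> (r < M)%N ->
  (rad r)^`M(k) = if r == k :> nat then z 0%N ^+ k.-1 else 0.
Proof.
case: r => [|r] k0 rM /=; first by rewrite mderiv1 ltn_eqF.
rewrite mderivM mderiv_expz0 // mulr0 addr0 mderiv_var //.
by case: eqVneq => [<-|]; rewrite ?mul1r ?mul0r.
Qed.

Lemma bracket_rad n j r : (0 < j)%N -> (r < M)%N ->
  bracket_field n j (rad r) =
  if (j <= r)%N then z 0%N ^+ j * (bracket_coef f n j r *: rad (r - j)) else 0.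
Proof.
case: r => [|r] j0 rM; first by rewrite bracket_field1 leqNgt j0.
rewrite bracket_fieldM bracket_field_expz0 ?mulr0 ?addr0 //; last first.
  exact: leq_ltn_trans rM.
rewrite bracket_field_var //; case: leqP => jr; last by rewrite mul0r.
rewrite -scalerAl -scalerAr; congr (_ *: _).
case e: (r.+1 - j)%N => [|i] /=.
  by rewrite mulr1 -exprS; congr (_ ^+ _); lia.
by rewrite mulrCA -exprD; congr (_ * _ ^+ _); lia.
Qed.

Let two0 : 2%:R != 0 :> f := natf_neq0 f_char0 (isT : (0 < 2)%N).

Lemma mul2_eq0 p : p *+ 2 = 0 -> p = 0.
Proof.
move/eqP; rewrite -scaler_nat -mul_mpolyC mulf_eq0 mpolyC_eq0 (negbTE two0).
by move/eqP.
Qed.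

(* s and t are the two square roots of the generating function, h = 1 / s, and
   Q is the coefficient of z^(N-m). *)
Section GeneratingFunction.
Variables (m N : nat) (mN : (m < N)%N) (NM : (N < M)%N).
Variables (s t h : nat -> S) (Q : S).
Hypotheses (s0 : s 0%N = 1) (t0 : t 0%N = 1).
Hypothesis s_sq : forall r, (r <= N)%N -> conv s s r = rad r.
Hypothesis t_sq : forall r, (r <= N)%N ->
  conv t t r = if (r <= m)%N then rad r else 0.
Hypothesis sh : forall r, conv s h r = (r == 0%N)%:R.
Hypothesis Qst : z 0%N ^+ m * Q = s N - t N.

Let z0_neq0 e : z 0%N ^+ e != 0.
Proof.
rewrite expf_neq0 // var_lt ?(leq_ltn_trans _ NM) // => M0.
by rewrite -msize_poly_eq0 msizeX.
Qed.

Lemma mderiv_t (k : 'I_M) r : (m < k)%N -> (r <= N)%N -> (t r)^`M(k) = 0.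
Proof.
move=> mk; move: r.
apply: (conv_cancel (s := t) (e := fun r => (t r)^`M(k))) => // r rN.
apply: mul2_eq0; rewrite -(conv_deriv (d := mderiv k)).
- rewrite t_sq //; case: leqP => rm; last exact: mderiv0.
  rewrite mderiv_rad ?(leq_ltn_trans _ mk) ?(leq_ltn_trans rN) //.
  by rewrite ltn_eqF // (leq_ltn_trans rm).
- exact: mderivD.
- exact: mderivM.
Qed.

(** Differentiating s^2 gives 2 s d_k s = x_0^(k-1) z^k. *)
Lemma mderiv_s (k : 'I_M) r : (0 < k)%N -> (r <= N)%N ->
  (s r)^`M(k) *+ 2 = if (k <= r)%N then z 0%N ^+ k.-1 * h (r - k)%N else 0.
Proof.
move=> k0 rN; apply/eqP; rewrite -subr_eq0; apply/eqP; move: r rN.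
apply: (conv_cancel (s := s)
  (e := fun r => (s r)^`M(k) *+ 2 -
    if (k <= r)%N then z 0%N ^+ k.-1 * h (r - k)%N else 0)) => // r rN.
rewrite convBr conv_shift sh.
have -> : conv s (fun i => (s i)^`M(k) *+ 2) r = (conv s s r)^`M(k).
  rewrite (conv_deriv (d := mderiv k)); [|exact: mderivD|exact: mderivM].
  by rewrite /conv -sumrMnl; apply: eq_bigr => i _; rewrite mulrnAr.
rewrite s_sq // mderiv_rad ?(leq_ltn_trans rN) //.
case: (ltngtP r k) => rk; last by rewrite rk subnn mulr1 subrr.
  exact: subrr.
by rewrite subn_eq0 leqNgt rk mulr0 subrr.
Qed.

(** The radicand a satisfies D_j a = x_0^j z^j ((2 N - 2 j) a - z a'); with
    a = s^2 this is D_j s = x_0^j z^j ((N - j) s - z s').  The factor N - r in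
    degree r makes D_j s_N vanish. *)
Lemma bracket_s j r : (0 < j)%N -> (r <= N)%N ->
  bracket_field (2 * N) j (s r) =
  if (j <= r)%N then z 0%N ^+ j * ((N%:R - r%:R) * s (r - j)%N) else 0.
Proof.
move=> j0 rN; apply/eqP; rewrite -subr_eq0; apply/eqP; move: r rN.
(* u is the series (N - j) s - z s'. *)
pose u i : S := (N%:R - j%:R - i%:R) * s i.
have uE r : (if (j <= r)%N then z 0%N ^+ j * ((N%:R - r%:R) * s (r - j)%N) else 0) =
    if (j <= r)%N then z 0%N ^+ j * u (r - j)%N else 0.
  case: leqP => // jr; rewrite /u natrB //; congr (_ * (_ * _)); ring.
pose e r := bracket_field (2 * N) j (s r) -
  if (j <= r)%N then z 0%N ^+ j * u (r - j)%N else 0.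
suff E r : (r <= N)%N -> e r = 0 by move=> r rN; rewrite uE; apply: E.
move: r; apply: (conv_cancel (s := s)) => // r rN.
rewrite convBr conv_shift; apply: mul2_eq0; rewrite mulrnBl.
rewrite -(conv_deriv (d := bracket_field (2 * N) j)); first last.
- exact: bracket_fieldM.
- by move=> x y; rewrite linearD.
rewrite s_sq // bracket_rad ?(leq_ltn_trans rN) //.
case: leqP => jr; last by rewrite mul0rn subrr.
rewrite -mulrnAr -mulrBr; apply/eqP; rewrite mulf_eq0; apply/orP; right.
set q := (r - j)%N.
have -> : conv s u q *+ 2 =
    (N%:R - j%:R - q%:R) *+ 2 * conv s s q +
    \sum_(i < q.+1) (i%:R *+ 2) * (s i * s (q - i)%N).
  rewrite /conv -sumrMnl mulr_sumr -big_split; apply: eq_bigr => i _ /=.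
  rewrite /u natrB; last by rewrite -ltnS.
  ring.
rewrite conv_weight s_sq; last by rewrite /q; lia.
rewrite -mul_mpolyC /bracket_coef !mpolyCB !mpolyC_nat /q natrM natrB //.
by rewrite subr_eq0; apply/eqP; ring.
Qed.

Lemma bracket_Q j : (m < j)%N -> bracket_field (2 * N) j Q = 0.
Proof.
move=> mj; have j0 : (0 < j)%N by exact: leq_ltn_trans mj.
have M0 : (0 < M)%N by exact: leq_ltn_trans NM.
have := congr1 (bracket_field (2 * N) j) Qst.
rewrite bracket_fieldM bracket_field_expz0 // mul0r add0r linearB /= bracket_s //.
rewrite subrr mul0r mulr0 if_same sub0r.
have -> : bracket_field (2 * N) j (t N) = 0.
  rewrite /bracket_field /vfield big1 // => k _; rewrite /shift.
  case: leqP => jk; last by rewrite mul0r.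
  by rewrite mderiv_t ?mulr0 // (leq_trans mj).
by rewrite oppr0 => /eqP; rewrite mulf_eq0 (negbTE (z0_neq0 _)) => /eqP.
Qed.

Lemma mderiv_Q (k : 'I_M) : (m < k)%N ->
  Q^`M(k) *+ 2 = if (k <= N)%N then z 0%N ^+ (k - m.+1) * h (N - k)%N else 0.
Proof.
move=> mk; have k0 : (0 < k)%N by exact: leq_ltn_trans mk.
have := congr1 (mderiv k) Qst.
rewrite mderivM mderiv_expz0 // mul0r add0r mderivB mderiv_t // subr0.
move/(congr1 (fun p => p *+ 2)); rewrite mderiv_s // -mulrnAr => E.
apply: (mulfI (z0_neq0 m)); rewrite {}E; case: leqP => kN; last by rewrite mulr0.
by rewrite mulrA -exprD; congr (_ ^+ _ * _); lia.
Qed.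

Lemma h0 : h 0%N = 1.
Proof. by have := sh 0; rewrite /conv big_ord1 s0 mul1r. Qed.

(* At this point x_0 = 0 and x_1 = 1, and the radicand becomes 1 + z. *)
Let pt (i : 'I_M) : f := (i == 1%N :> nat)%:R.

Lemma meval_h_neq0 r : (r <= N)%N -> (h r).@[pt] != 0.
Proof.
have convE (u v : nat -> S) a : (conv u v a).@[pt] =
    conv (fun i => (u i).@[pt]) (fun i => (v i).@[pt]) a.
  by rewrite /conv rmorph_sum; apply: eq_bigr => i _; rewrite rmorphM.
have zE i : (i < M)%N -> (z i).@[pt] = (i == 1%N)%:R.
  by move=> iM; rewrite var_lt mevalXU.
apply: (inv_sqrt_coef_neq0 f_char0 (B := N) (s := fun r => (s r).@[pt])
  (c := fun r => (h r).@[pt])) => {}r rN.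
  rewrite -convE s_sq //; case: r rN => [|r] rN /=; first by rewrite meval1.
  rewrite mevalM rmorphXn /= !zE ?(leq_ltn_trans _ NM) //.
  by case: r {rN} => [|r]; rewrite ?mul0r //= expr0 mulr1.
by rewrite -convE sh rmorph_nat.
Qed.

End GeneratingFunction.
End Invariants.

(** * The ring of invariants *)

Section InvariantRing.
Variables (f : fieldType) (f_char0 : [pchar f] =i pred0) (M : nat).
Local Notation S := {mpoly f[M]}.
Local Notation z := (var f M).
Implicit Types (p q c : S) (n j : nat) (k : 'I_M).

(** Downward induction on k: in the equation of index j = k the terms of smaller
    index are absent, those of larger index vanish by induction, and the diagonal
    coefficient (n - 2 k) x_0 is not zero. *)
Lemma triangular (v : 'I_M -> S) n lo hi :
    (forall k, (hi < k)%N -> v k = 0) ->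
    (forall j, (lo < j <= hi)%N -> \sum_k shift (bracket_coef f n j) j k * v k = 0) ->
    (forall j, (lo < j <= hi)%N -> n != (2 * j)%N) ->
  forall k, (lo < k)%N -> v k = 0.
Proof.
move=> vhi vsum nj.
suff H e : forall k : 'I_M, (lo < k)%N -> (hi < k + e)%N -> v k = 0.
  by move=> k lok; apply: (H hi.+1) => //; rewrite addnS ltnS leq_addl.
elim: e => [|e IH] k lok hik; first by apply: vhi; rewrite -[k : nat]addn0.
have [hk|kh] := ltnP hi k; first exact: vhi.
have kb : (lo < k <= hi)%N by rewrite lok.
have := vsum k kb; rewrite (bigD1 k) //= big1 ?addr0 => [|i ik].
  rewrite /shift leqnn subnn => /eqP; rewrite mulf_eq0 => /orP[|/eqP//].
  have M0 : (0 < M)%N by apply: leq_ltn_trans (ltn_ord k).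
  rewrite -mul_mpolyC mulf_eq0 mpolyC_eq0 (var_lt _ M0) -msize_poly_eq0 msizeX orbF.
  rewrite /bracket_coef -addrA -opprD -natrD subr_eq0 => /eqP/(natf_inj f_char0) E.
  by have := nj k kb; rewrite E addnn mul2n eqxx.
rewrite /shift; case: leqP => ki; last by rewrite mul0r.
have {}ki : (k < i)%N by rewrite ltn_neqAle ki andbT eq_sym.
by rewrite IH ?mulr0 ?(ltn_trans lok) //; lia.
Qed.

Section Divisibility.
Hypothesis M0 : (0 < M)%N.

(* The substitution x_0 = 0. *)
Let eps : S -> S :=
  mmap (@mpolyC M f) (fun i : 'I_M => if i == 0%N :> nat then 0 else 'X_i).

Lemma eps_decomp p : exists w, p = eps p + z 0%N * w.
Proof.
elim/mpoly_alg_ind: p => [a|i|p q [u Hu] [v Hv]|p q [u Hu] [v Hv]].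
- by exists 0; rewrite /eps mmapC mulr0 addr0.
- rewrite /eps mmapX mmap1U; case: eqP => i0.
    by exists 1; rewrite add0r mulr1 (var_lt _ M0); congr 'X_ _; apply/val_inj.
  by exists 0; rewrite mulr0 addr0.
- exists (u + v); rewrite /eps rmorphD /= -!/(eps _) mulrDr addrACA.
  by rewrite -Hu -Hv.
- exists (u * q + eps p * v); rewrite /eps rmorphM /= -!/(eps _).
  by rewrite {1}Hu mulrDl {1}Hv; ring.
Qed.

(** If g does not vanish identically on x_0 = 0, it is prime to x_0. *)
Lemma var0_pow_dvd (pt : 'I_M -> f) a u g v :
    (forall i : 'I_M, i = 0%N :> nat -> pt i = 0) -> g.@[pt] != 0 ->
  z 0%N ^+ a * u = g * v -> exists q, v = z 0%N ^+ a * q.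
Proof.
move=> pt0 gpt; have zE : z 0%N = 'X_(Ordinal M0) by rewrite var_lt.
have z0 : z 0%N != 0 by rewrite zE -msize_poly_eq0 msizeX.
have epsz : eps (z 0%N) = 0 by rewrite zE /eps mmapX mmap1U.
have epsM x y : eps (x * y) = eps x * eps y by rewrite /eps rmorphM.
have epsg : eps g != 0.
  have [w gw] := eps_decomp g; apply: contraNneq gpt => g0.
  by rewrite gw g0 add0r mevalM zE mevalXU pt0 ?mul0r.
elim: a u v => [|a IH] u v; first by exists v; rewrite mul1r.
rewrite exprS -mulrA => E; have /eqP := congr1 eps E.
rewrite !epsM epsz mul0r eq_sym mulf_eq0 (negbTE epsg) /= => /eqP v0.
have [w vw] := eps_decomp v; rewrite v0 add0r in vw; subst v.
have [|q ->] := IH u w; last by exists q; rewrite mulrA.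
by apply: (mulfI z0); rewrite E mulrCA.
Qed.

End Divisibility.

(** The polynomials in Q with coefficients in f[x_0, ..., x_m]; in
    characteristic 0 the latter is the kernel of the derivatives of index
    larger than m. *)
Definition poly_in Q m p := exists e (c : nat -> S),
  p = \sum_(i < e) c i * Q ^+ i /\
  forall i (k : 'I_M), (m < k)%N -> (c i)^`M(k) = 0.

Section GeneratingInvariant.
Variables (m N : nat) (mN : (m < N)%N) (NM : (N < M)%N).
Variables (s t h : nat -> S) (Q : S).
Hypotheses (s0 : s 0%N = 1) (t0 : t 0%N = 1).
Hypothesis s_sq : forall r, (r <= N)%N -> conv s s r = rad f M r.
Hypothesis t_sq : forall r, (r <= N)%N ->
  conv t t r = if (r <= m)%N then rad f M r else 0.
Hypothesis sh : forall r, conv s h r = (r == 0%N)%:R.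
Hypothesis Qst : z 0%N ^+ m * Q = s N - t N.

Let DQ j : (m < j)%N -> bracket_field (2 * N) j Q = 0.
Proof. exact: (bracket_Q f_char0 mN NM s0 t0 s_sq t_sq Qst). Qed.

Let dQ (k : 'I_M) : (m < k)%N -> Q^`M(k) *+ 2 =
  if (k <= N)%N then z 0%N ^+ (k - m.+1) * h (N - k)%N else 0.
Proof. exact: (mderiv_Q f_char0 mN NM s0 t0 s_sq t_sq sh Qst). Qed.

(** With W a primitive of 2 q as a polynomial in Q, the difference p - W has no
    derivative in the directions k > m, so it is a constant of integration in
    f[x_0, ..., x_m]. *)
Lemma poly_in_integrate p q :
    poly_in Q m q -> (forall k : 'I_M, (m < k)%N -> p^`M(k) = q * (Q^`M(k) *+ 2)) ->
  poly_in Q m p.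
Proof.
move=> [e [c [-> cm]]] Hp.
pose W := \sum_(i < e) ((i.+1)%:R^-1 *: (c i *+ 2)) * Q ^+ i.+1.
have dW (k : 'I_M) : (m < k)%N -> W^`M(k) = p^`M(k).
  move=> mk; rewrite Hp // raddf_sum mulr_suml; apply: eq_bigr => i _ /=.
  rewrite mderivM mderivZ raddfMn /= cm // mul0rn scaler0 mul0r add0r.
  have -> : (Q ^+ i.+1)^`M(k) = i.+1%:R *: (Q ^+ i * Q^`M(k)).
    elim: (i : nat) => [|b IH]; first by rewrite expr1 expr0 mul1r scale1r.
    rewrite exprS mderivM IH -!mul_mpolyC !mpolyC_nat !exprS -[b.+2]addn1 natrD.
    ring.
  rewrite -scalerAl -scalerAr scalerA mulVf ?scale1r ?natf_neq0 //.
  ring.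
exists e.+1, (fun i => if i is b.+1 then b.+1%:R^-1 *: (c b *+ 2) else p - W).
split=> [|[|i] k mk]; last 2 first.
- by rewrite mderivB dW // subrr.
- by rewrite mderivZ raddfMn /= cm // mul0rn scaler0.
by rewrite big_ord_recl expr0 mulr1 -[LHS](subrK W).
Qed.

(** Along x_k with k > m, the gradient of p equals q times that of 2 Q, where
    q is an invariant of smaller degree than p. *)
Lemma invariant_ring p :
    (forall k : 'I_M, (N < k)%N -> p^`M(k) = 0) ->
    (forall j, (m < j < N)%N -> bracket_field (2 * N) j p = 0) ->
  poly_in Q m p.
Proof.
move: {2}(msize p) (leqnn (msize p)) => d.
elim: d p => [|d IH] p.
  rewrite leqn0 msize_poly_eq0 => /eqP-> _ _; exists 0%N, (fun=> 0).
  by split=> [|i k _]; rewrite ?big_ord0 ?mderiv0.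
move=> pd pN pD.
have M0 : (0 < M)%N by exact: leq_ltn_trans NM.
have mM : (m.+1 < M)%N by exact: leq_ltn_trans NM.
pose oN := Ordinal NM; pose om := Ordinal mM; pose a := (N - m.+1)%N.
have z0 e : z 0%N ^+ e != 0.
  by rewrite expf_neq0 // (var_lt _ M0) -msize_poly_eq0 msizeX.
have hN : h 0%N = 1 by exact: (h0 s0 sh).
(* Since 2 dQ/dx_N = x_0^a, the vanishing of v says that the gradients of p and
   Q are proportional. *)
pose v (k : 'I_M) := z 0%N ^+ a * p^`M(k) - p^`M(oN) * (Q^`M(k) *+ 2).
have v0 (k : 'I_M) : (m < k)%N -> v k = 0.
  apply: (triangular (n := (2 * N)%N) (hi := N.-1)) => {k} [k Nk|j /andP[mj jN]|j].
  - have [kN|Nk'] := leqP k N.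
      have kE : k = oN by apply/val_inj => /=; lia.
      by rewrite /v kE dQ //= leqnn subnn hN mulr1 mulrC subrr.
    rewrite /v pN // dQ ?(ltn_trans mN) // leqNgt Nk' /=.
    by rewrite !mulr0 subrr.
  - have E w : \sum_k shift (bracket_coef f (2 * N) j) j k * w^`M(k) =
      bracket_field (2 * N) j w by [].
    transitivity (z 0%N ^+ a * bracket_field (2 * N) j p -
                  p^`M(oN) * (bracket_field (2 * N) j Q *+ 2)).
      rewrite -!E -sumrMnl !mulr_sumr -sumrB; apply: eq_bigr => k _.
      by rewrite /v; ring.
    by rewrite DQ // pD ?mul0rn ?mulr0 ?subrr //; lia.
  - by move=> jb; apply/eqP; lia.
have pE (k : 'I_M) : (m < k)%N ->
    z 0%N ^+ a * p^`M(k) = p^`M(oN) * (Q^`M(k) *+ 2).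
  by move=> mk; apply/eqP; rewrite -subr_eq0; apply/eqP/v0.
(* Compare the equations for k = m + 1 and k = N: 2 dQ/dx_(m+1) = h_a is prime
   to x_0. *)
have [q qE] : exists q, p^`M(oN) = z 0%N ^+ a * q.
  have := pE om (ltnSn m); rewrite dQ //= mN subnn mul1r mulrC.
  rewrite [RHS]mulrC; move: (meval_h_neq0 f_char0 NM s_sq sh (leq_subr m.+1 N)).
  rewrite [_ * z _ ^+ _]mulrC; apply: (var0_pow_dvd M0) => i i0.
  by rewrite i0.
have qI : poly_in Q m q.
  apply: IH.
  - have [->|q0] := eqVneq q 0; first by rewrite msize0.
    have pN0 : p^`M(oN) != 0 by rewrite qE mulf_neq0.
    have := leq_trans (msize_mderiv pN0) pd; rewrite ltnS qE msizeM //.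
    have : msize (z 0%N ^+ a) != 0%N by rewrite msize_poly_eq0.
    by move: (msize _) (msize _) => b1 b2; lia.
  - move=> k Nk; apply: (mulfI (z0 a)); rewrite mulr0.
    have k0 : (0 < k)%N by exact: leq_ltn_trans Nk.
    have := congr1 (mderiv k) qE; rewrite mderivM mderiv_expz0 // mul0r add0r => <-.
    by rewrite mderiv_comm pN // mderiv0.
  - move=> j jb; have j0 : (0 < j)%N by lia.
    apply: (mulfI (z0 a)); rewrite mulr0.
    have := congr1 (bracket_field (2 * N) j) qE.
    rewrite bracket_fieldM bracket_field_expz0 // mul0r add0r => <-.
    rewrite /bracket_field vfield_mderiv -/(bracket_field _ _ _) pD // mderiv0 sub0r.
    rewrite /vfield big1 ?oppr0 // => i _.
    have [iN|Ni] := leqP i N; last by rewrite pN ?mulr0.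
    rewrite /shift; case: leqP => ji; last by rewrite mderiv0 mul0r.
    rewrite mderivZ mderiv_var; last by have := ltn_ord i; lia.
    by rewrite ltn_eqF ?scaler0 ?mul0r //=; lia.
apply: poly_in_integrate qI _ => k mk; apply: (mulfI (z0 a)).
by rewrite pE // qE mulrA.
Qed.

End GeneratingInvariant.
End InvariantRing.

(** * The polynomials P_mk as coefficients of polynomial series *)

Section PmkSeries.
Variables (f : fieldType) (f_char0 : [pchar f] =i pred0).

Let two0 : 2%:R != 0 :> f := natf_neq0 f_char0 (isT : (0 < 2)%N).

Lemma is_sqrt1_tofrac N (a s : nat -> {mpoly f[N]}) :
    s 0%N = 1 -> (forall r, conv s s r = a r) ->
  is_sqrt1 (fun r => tofrac (a r)) (fun r => tofrac (s r)).
Proof.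
move=> s0 sE; split=> [|r]; first by rewrite s0 rmorph1.
by rewrite -sE /conv rmorph_sum; apply: eq_bigr => i _; rewrite rmorphM.
Qed.

(** The square roots have polynomial coefficients, so that the fraction defining
    P can be cleared and its variables substituted. *)
Lemma Pmk_series m k (P : {mpoly f[(m + k).+1]}) M :
    (m + k < M)%N -> is_Pmk m k P ->
  exists s t : nat -> {mpoly f[M]},
    [/\ s 0%N = 1, t 0%N = 1,
      forall r, (r <= m + k)%N -> conv s s r = rad f M r,
      forall r, (r <= m + k)%N -> conv t t r = if (r <= m)%N then rad f M r else 0 &
      var f M 0 ^+ m * eval_mpoly P (var f M) = s (m + k)%N - t (m + k)%N].
Proof.
move=> NM [sF [tF [sFE tFE PE]]]; set N := (m + k)%N in NM sFE tFE PE *.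
have sqrt_ex a : a 0%N = 1 -> exists2 u : nat -> {mpoly f[N.+1]},
    u 0%N = 1 & forall r, conv u u r = a r.
  exact: (@conv_sqrt_exists f two0 {mpoly f[N.+1]}).
have [s s0 s_sq] := sqrt_ex (rad f N.+1) (erefl _).
have [t t0 t_sq] := sqrt_ex (fun r => if (r <= m)%N then rad f N.+1 r else 0) (erefl _).
have xE j : indet f N j = tofrac (var f N.+1 j).
  by rewrite /indet /var; case: insub => // ; rewrite rmorph0.
have z0 : var f N.+1 0 != 0.
  by rewrite var_lt -msize_poly_eq0 msizeX.
have radE r : radicand (indet f N) r = tofrac (rad f N.+1 r).
  rewrite /radicand !xE; case: r => [|r].
    by rewrite sub0r -invr_expz expr1z divff ?rmorph1 // tofrac_eq0.
  have -> : r.+1%:Z - 1 = r by rewrite -[r.+1]addn1 PoszD addrK.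
  by rewrite rmorphM rmorphXn.
have twoF : 2%:R != 0 :> {fraction {mpoly f[N.+1]}}.
  by rewrite -(rmorph_nat (@tofrac _)) tofrac_eq0 -mpolyC_nat mpolyC_eq0.
have sN : sF N = tofrac (s N).
  by apply: (sqrt1_local twoF sFE (is_sqrt1_tofrac s0 s_sq)) => i _.
have tN : tF N = tofrac (t N).
  apply: (sqrt1_local twoF tFE (is_sqrt1_tofrac t0 t_sq)) => i _.
  by rewrite /truncate radE; case: ifP => //; rewrite rmorph0.
have PA : var f N.+1 0 ^+ m * P = s N - t N.
  apply/eqP; rewrite -tofrac_eq rmorphM rmorphB /= -sN -tN rmorphXn PE xE mulrC.
  by rewrite divfK ?expf_neq0 ?tofrac_eq0.
pose iota : {rmorphism {mpoly f[N.+1]} -> {mpoly f[M]}} :=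
  mmap (in_alg {mpoly f[M]}) (fun i : 'I_N.+1 => var f M i).
have iota_var i : (i <= N)%N -> iota (var f N.+1 i) = var f M i.
  by move=> iN; rewrite var_lt /iota /= mmapX mmap1U.
have iota_rad r : (r <= N)%N -> iota (rad f N.+1 r) = rad f M r.
  case: r => [|r] rN; first exact: rmorph1.
  by rewrite /rad rmorphM rmorphXn !iota_var.
have iota_conv u r : iota (conv u u r) = conv (iota \o u) (iota \o u) r.
  by rewrite /conv rmorph_sum; apply: eq_bigr => i _; rewrite rmorphM.
exists (iota \o s), (iota \o t); split => /=.
- by rewrite s0 rmorph1.
- by rewrite t0 rmorph1.
- by move=> r rN; rewrite -iota_conv s_sq iota_rad.
- by move=> r rN; rewrite -iota_conv t_sq; case: ifP; rewrite ?rmorph0 // iota_rad.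
- by rewrite -rmorphB -PA rmorphM rmorphXn iota_var.
Qed.

End PmkSeries.

(** * Evaluation of polynomials at commuting elements *)

Section CommutingEvaluation.
Variables (f : fieldType) (U : algType f) (M : nat) (y : 'I_M -> U).
Local Notation S := {mpoly f[M]}.
Implicit Types p q : S.

Section Support.
Variables (f_char0 : [pchar f] =i pred0) (K : nat) (p : S).
Hypothesis pK : forall k : 'I_M, (K <= k)%N -> p^`M(k) = 0.

(** In characteristic 0 a vanishing derivative excludes the variable. *)
Lemma support_mderiv0 mon (k : 'I_M) :
  mon \in msupp p -> (K <= k)%N -> mon k = 0%N.
Proof.
move=> mp Kk; apply/eqP; apply: contraTT mp; rewrite -lt0n => mk.
have := congr1 (mcoeff (mon - U_(k))%MM) (pK Kk).
rewrite mcoeff_mderiv mcoeff0 submK; last first.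
  by apply/mnm_lepP => i; rewrite mnm1E; case: eqP => // <-.
rewrite mcoeff_msupp negbK -mulr_natr => /eqP.
by rewrite mulf_eq0 (negbTE (natf_neq0 f_char0 _)) ?orbF.
Qed.

Lemma ordered_subalg (G : seq U) :
    (forall k : 'I_M, (k < K)%N -> y k \in G) -> in_subalg G (ordered y p).
Proof.
move=> yG; apply: in_subalg_sum => mon mp; rewrite /= mulr_algl.
apply/in_subalgZ/in_subalg_prod => k.
have [kK|Kk] := ltnP k K; first exact/in_subalgX/in_subalg_gen/yG.
by rewrite support_mderiv0 // expr0; apply: in_subalg1.
Qed.

Lemma ordered_ext (y' : 'I_M -> U) :
  (forall k : 'I_M, (k < K)%N -> y k = y' k) -> ordered y p = ordered y' p.
Proof.
move=> yy'; apply: eq_big_seq => mon mp; congr (_ * _).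
apply: eq_bigr => k _; have [kK|Kk] := ltnP k K; first by rewrite yy'.
by rewrite support_mderiv0.
Qed.
End Support.

Lemma ordered1 : ordered y 1 = 1.
Proof. by rewrite /ordered -mpolyC1 mmapC /= scale1r. Qed.

Lemma orderedX i : ordered y 'X_i = y i.
Proof. by rewrite /ordered mmapX mmap1U. Qed.

Lemma orderedC a : ordered y a%:MP = a%:A.
Proof. by rewrite /ordered mmapC. Qed.

Hypothesis yC : forall i j, GRing.comm (y i) (y j).

Lemma mmap1_commM (m1 m2 : 'X_{1..M}) :
  mmap1 y (m1 + m2)%MM = mmap1 y m1 * mmap1 y m2.
Proof.
suff [] : mmap1 y (m1 + m2)%MM = mmap1 y m1 * mmap1 y m2 /\
    forall i, GRing.comm (y i) (mmap1 y m1) by [].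
rewrite /mmap1; elim/big_rec3: _ => [|i y1 y2 y3 _ [-> y2C]].
  by split=> [|i]; [rewrite mulr1|apply: commr1].
split=> [|j]; last by apply: commrM (y2C j); apply: commrX.
rewrite mnmDE exprD -!mulrA; congr (_ * _); rewrite !mulrA; congr (_ * _).
exact/commr_sym/commrX/commr_sym.
Qed.

Lemma orderedM p q : ordered y (p * q) = ordered y p * ordered y q.
Proof.
elim/mpolyind: p => [|a mon p _ _ IH]; first by rewrite mul0r /ordered mmap0 mul0r.
rewrite mulrDl !orderedD mulrDl IH; congr (_ + _).
rewrite -scalerAl !orderedZ -scalerAl; congr (_ *: _).
elim/mpolyind: q {p IH} => [|b mon' q _ _ IHq].
  by rewrite mulr0 /ordered mmap0 mulr0.
rewrite mulrDr !orderedD mulrDr IHq; congr (_ + _).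
rewrite -scalerAr !orderedZ -scalerAr -mpolyXD; congr (_ *: _).
by rewrite /ordered !mmapX mmap1_commM.
Qed.

Lemma orderedXn p e : ordered y (p ^+ e) = ordered y p ^+ e.
Proof.
by elim: e => [|e IH]; rewrite ?expr0 ?ordered1 // !exprS orderedM IH.
Qed.

Lemma ordered_eval N (P : {mpoly f[N.+1]}) (Y : nat -> U) :
    (forall i : 'I_M, (i <= N)%N -> y i = Y i) -> (N < M)%N ->
  ordered y (eval_mpoly P (var f M)) = eval_mpoly P Y.
Proof.
move=> yY NM; rewrite /eval_mpoly /mmap.
rewrite (big_morph (ordered y) (orderedD y) (mmap0 _ _)); apply: eq_bigr => mon _.
rewrite /= !mulr_algl orderedZ; congr (_ *: _).
rewrite /mmap1 (big_morph (ordered y) orderedM ordered1); apply: eq_bigr => i _.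
have iN : (i <= N)%N by rewrite -ltnS.
by rewrite orderedXn (var_lt f (leq_ltn_trans iN NM)) orderedX yY.
Qed.

End CommutingEvaluation.

(** * The center *)

Section Center.
Variables (f : fieldType) (f_char0 : [pchar f] =i pred0).
Variables (m n : nat) (mn : (m < n)%N).
Local Notation D := (n.+1 - m.+1)%N.
Local Notation l := (Lquo_l f m.+1 n.+1).
Variables (U : algType f) (inc : {linear Lquo f m.+1 n.+1 -> U}).
Hypothesis U_env : is_enveloping inc.
Local Notation y := (gen inc).
Local Notation Y := (ogen inc).

Lemma center_gens u :
  (forall j, (m < j <= n)%N -> inc (l j) * u = u * inc (l j)) -> in_center u.
Proof.
move=> Hu; apply/(centerP U_env); elim/(@Lquo_ind f m n mn) => //.
- by rewrite linear0 mul0r mulr0.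
- by move=> a x x' Hx Hx'; rewrite linearP mulrDl mulrDr -scalerAl -scalerAr Hx Hx'.
Qed.

Lemma enveloping_comm : (n <= 2 * m + 2)%N -> forall u v : U, u * v = v * u.
Proof.
move=> nm u; elim/(enveloping_ind U_env): u => [a|x|u w Hu Hw|u w Hu Hw] v.
- by rewrite mulr_algl mulr_algr.
- move: v; rewrite -/(in_center (inc x));
  elim/(@Lquo_ind f m n mn): x => [|a x x' Hx Hx'|i Hi].
  + by move=> v; rewrite /GRing.comm linear0 mul0r mulr0.
  + by move=> v; rewrite /GRing.comm linearP mulrDl mulrDr -scalerAl -scalerAr Hx Hx'.
  apply: center_gens => j Hj; apply/eqP; rewrite -subr_eq0.
  rewrite (l_commutator mn U_env); [|by case/andP: Hj|by case/andP: Hi].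
  have [->|ij] := eqVneq i j; first by rewrite subrr scale0r.
  by rewrite Lquo_l_eq0 ?linear0 ?scaler0 //; lia.
- by rewrite mulrDl mulrDr Hu Hw.
- by rewrite -mulrA Hw mulrA Hu mulrA.
Qed.

Lemma gen_central k : (k <= m)%N -> (2 * m + 2 <= n)%N -> in_center (y k).
Proof.
move=> km nm; apply: center_gens => j Hj; apply/eqP; rewrite -subr_eq0.
rewrite (gen_commutator mn U_env Hj); last by lia.
by case: leqP => //; lia.
Qed.

(** Here the triangular system applies to the derivatives of p themselves; it
    determines them as long as n differs from 2 k. *)
Lemma invariant_support K (p : {mpoly f[D]}) :
    (m <= K)%N -> (forall j, (K < j)%N -> n != (2 * j)%N) ->
    (forall j, (m < j <= n)%N -> bracket_field n j p = 0) ->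
  forall k : 'I_D, (K < k)%N -> p^`M(k) = 0.
Proof.
move=> mK nK pD; apply: (triangular f_char0 (n := n) (hi := D.-1)) => [k|j|j].
- by have := ltn_ord k; lia.
- by move=> Hj; apply: pD; lia.
- by case/andP => Kj _; apply: nK.
Qed.

Local Notation ls := [seq y i | i <- iota 0 m.+1].

Lemma mem_gens k : (k <= m)%N -> y k \in ls.
Proof. by move=> km; apply/map_f; rewrite mem_iota. Qed.

Lemma center_odd : (2 * m + 2 <= n)%N -> odd n ->
  forall u, in_center u <-> in_subalg ls u.
Proof.
move=> nm nodd u.
have lsC g : g \in ls -> in_center g.
  by case/mapP => i; rewrite mem_iota => im ->; apply: gen_central.
split=> [|Hu]; last exact: subalg_central lsC Hu.
apply: (center_subalg mn U_env lsC) => p pD.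
apply: (ordered_subalg f_char0 (K := m.+1)) => k mk; last exact: mem_gens.
apply: (invariant_support (leqnn m)) mk => // j _.
by apply: contraTneq nodd => ->; rewrite mul2n odd_double.
Qed.

Section Even.
Variables (k : nat) (P : {mpoly f[(m + k).+1]}).
Hypotheses (k_gt0 : (0 < k)%N) (nE : n = (2 * (m + k))%N) (HP : is_Pmk m k P).
Local Notation N := (m + k)%N.
Local Notation Q := (eval_mpoly P (var f D) : {mpoly f[D]}).
Local Notation QU := (eval_mpoly P y).

Let ND : (N < D)%N. Proof. by lia. Qed.
Let mN : (m < N)%N. Proof. by lia. Qed.

(** The elements y_0, ..., y_N commute; the remaining ones are replaced by 0 so
    that evaluation is multiplicative on the whole polynomial ring. *)
Definition abelian_gen (i : 'I_D) : U := if (i <= N)%N then Y i else 0.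

Lemma abelian_gen_comm i j : GRing.comm (abelian_gen i) (abelian_gen j).
Proof.
rewrite /abelian_gen; case: leqP => iN; last by rewrite /GRing.comm mul0r mulr0.
case: leqP => jN; last by rewrite /GRing.comm mul0r mulr0.
apply/eqP; rewrite -subr_eq0 /ogen /gen (l_commutator mn U_env); try lia.
have [->|ij] := eqVneq i j; first by rewrite subrr scale0r.
move: ij; rewrite -val_eqE /= => ij.
by rewrite Lquo_l_eq0 ?linear0 ?scaler0 //; lia.
Qed.

Let evalE (p : {mpoly f[N.+1]}) :
  ordered abelian_gen (eval_mpoly p (var f D)) = eval_mpoly p y.
Proof.
apply: ordered_eval => //; first exact: abelian_gen_comm.
by move=> i iN; rewrite /abelian_gen iN.
Qed.

(** The bracket with l_j is a derivation, and so is D_j; they agree on the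
    variables, hence on all polynomials in the commuting y_0, ..., y_N. *)
Lemma eval_commutator j (p : {mpoly f[N.+1]}) : (m < j <= n)%N ->
  inc (l j) * eval_mpoly p y - eval_mpoly p y * inc (l j) =
  ordered abelian_gen (bracket_field n j (eval_mpoly p (var f D))).
Proof.
move=> Hj; rewrite -!evalE.
pose iota : {rmorphism {mpoly f[N.+1]} -> {mpoly f[D]}} :=
  mmap (in_alg {mpoly f[D]}) (fun i : 'I_N.+1 => var f D i).
have iotaE q : eval_mpoly q (var f D) = iota q by [].
rewrite iotaE.
elim/mpoly_alg_ind: p => [a|i|p q Hp Hq|p q Hp Hq].
- rewrite /iota /= mmapC /= -mul_mpolyC mulr1 /bracket_field vfieldC.
  by rewrite orderedC mulr_algl mulr_algr subrr /ordered mmap0.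
- have iN : (i <= N)%N by rewrite -ltnS.
  have iD := leq_ltn_trans iN ND.
  rewrite /iota /= mmapX mmap1U bracket_field_var // (var_lt f iD) orderedX.
  rewrite /abelian_gen /= iN /ogen (gen_commutator mn U_env Hj) //=.
  case: leqP => ji; last by rewrite /ordered mmap0.
  have jD : (i - j < D)%N by lia.
  rewrite orderedZ (var_lt f jD) orderedX /abelian_gen /=.
  by rewrite (leq_trans (leq_subr _ _) iN).
- by rewrite rmorphD linearD !orderedD mulrDr mulrDl opprD addrACA Hp Hq.
- rewrite rmorphM bracket_fieldM orderedD !(orderedM abelian_gen_comm) -Hp -Hq.
  by rewrite mulrBl mulrBr !mulrA addrA subrK.
Qed.

Lemma center_even u : in_center u <-> in_subalg (rcons ls QU) u.
Proof.
have nm : (2 * m + 2 <= n)%N by lia.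
have [s [t [s0 t0 s_sq t_sq Qst]]] := Pmk_series f_char0 ND HP.
have [h sh] := conv_inv_exists s0.
have lsC g : g \in rcons ls QU -> in_center g.
  rewrite mem_rcons inE => /orP[/eqP->|].
    apply: center_gens => j Hj; apply/eqP; rewrite -subr_eq0.
    have mj : (m < j)%N by case/andP: Hj.
    have := bracket_Q f_char0 mN ND s0 t0 s_sq t_sq Qst mj; rewrite -nE => bQ.
    by rewrite eval_commutator // bQ /ordered mmap0.
  by case/mapP => i; rewrite mem_iota => im ->; apply: gen_central.
split=> [|Hu]; last exact: subalg_central lsC Hu.
apply: (center_subalg mn U_env lsC) => p pD.
have pN (i : 'I_D) : (N.+1 <= i)%N -> p^`M(i) = 0.
  by apply: invariant_support => // [|j jN]; [exact: leq_addr|apply/eqP; lia].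
have [|e [c [pE cm]]] := invariant_ring f_char0 mN ND s0 t0 s_sq t_sq sh Qst pN.
  by move=> j Hj; rewrite -nE; apply: pD; lia.
rewrite (ordered_ext f_char0 pN (y' := abelian_gen)); last first.
  by move=> i; rewrite ltnS /abelian_gen => ->.
rewrite pE (big_morph _ (orderedD abelian_gen) (mmap0 _ _)).
apply: in_subalg_sum => i _; rewrite (orderedM abelian_gen_comm).
rewrite (orderedXn abelian_gen_comm) evalE; apply: in_subalgM.
  apply: (ordered_subalg f_char0 (K := m.+1)) => [j|j jm]; first exact: cm.
  rewrite mem_rcons inE /abelian_gen ifT ?mem_gens ?orbT //.
  by apply: leq_trans (ltnW mN).
by apply/in_subalgX/in_subalg_gen; rewrite mem_rcons mem_head.
Qed.

End Even.
End Center.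

Theorem theorem1 (f : fieldType) (f_char0 : [pchar f] =i pred0)
    (m n : nat) (mn : (m < n)%N)
    (U : algType f) (inc : {linear Lquo f m.+1 n.+1 -> U})
    (U_env : is_enveloping inc) :
  let l i : U := inc (Lquo_l f m.+1 n.+1 i) in
  let ls : seq U := [seq l (n - i)%N | i <- iota 0 m.+1] in
  ((n <= 2 * m + 2)%N -> forall u v : U, u * v = v * u)
  /\
  ((2 * m + 2 <= n)%N ->
    (odd n -> forall u : U, in_center u <-> in_subalg ls u)
    /\
    (~~ odd n -> let k := (n./2 - m)%N in
       forall P : {mpoly f[(m + k).+1]}, is_Pmk m k P ->
       forall u : U, in_center u <->
         in_subalg (rcons ls (eval_mpoly P (fun i => l (n - i)%N))) u)).
Proof.
split; first exact: (enveloping_comm mn U_env).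
move=> nm; split; first exact: (center_odd f_char0 mn U_env nm).
move=> neven k P HP u; apply: (center_even f_char0 mn U_env _ _ HP).
  by rewrite /k; lia.
by rewrite /k; lia.
Qed.
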